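(* Let $K$ be a (commutative) Noetherian ring, let $c\ge 1$ be an integer and let $\mathcal{P}=K[X_{c\times\mathbb{N}}]$. Then any $\operatorname{Inc}$-submodule $\mathcal{M}$ of a finitely generated free $\operatorname{Inc}$-module over $\mathcal{P}$ admits an $\operatorname{Inc}$-equivariant free resolution, that is, there is an exact sequence $$\cdots\to\mathcal{F}_2\to\mathcal{F}_1\to\mathcal{M}\to 0$$ with $\operatorname{Inc}$-equivariant differentials and free $\mathcal{P}$-modules $\mathcal{F}_i$ that are finitely generated as $\operatorname{Inc}$-modules. Moreover, if $\mathcal{M}$ is a graded module, then a graded such resolution exists, i.e. the differentials have degree zero.
   Context: $\mathbb{N}=\{1,2,\dots\}$. $\operatorname{Inc}$ is the monoid (under composition) of strictly increasing maps $\mathbb{N}\to\mathbb{N}$. $\mathcal{P}=K[X_{c\times\mathbb{N}}]=K[x_{i,j}\mid 1\le i\le c,\ j\in\mathbb{N}]$, with $\operatorname{Inc}$ acting by $K$-algebra homomorphisms via $\tau\cdot x_{i,j}=x_{i,\tau(j)}$. An $\operatorname{Inc}$-module over $\mathcal{P}$ is a $\mathcal{P}$-module $\mathcal{M}$ with an action of the monoid $\operatorname{Inc}$ satisfying $\tau\cdot(q_1+q_2)=\tau\cdot q_1+\tau\cdot q_2$ and $\tau\cdot(aq)=(\tau\cdot a)(\tau\cdot q)$ for $\tau\in\operatorname{Inc}$, $a\in\mathcal{P}$, $q,q_1,q_2\in\mathcal{M}$. Morphisms are the $\operatorname{Inc}$-equivariant $\mathcal{P}$-module homomorphisms. An $\operatorname{Inc}$-submodule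 is a $\mathcal{P}$-submodule stable under $\operatorname{Inc}$. An $\operatorname{Inc}$-module is finitely generated if there is a finite subset not contained in any proper $\operatorname{Inc}$-submodule. For $d\ge0$ let $\operatorname{Hom}_{\mathrm{OI}}(d,\mathbb{N})$ be the set of strictly increasing maps $\{1,\dots,d\}\to\mathbb{N}$. Let $\mathcal{F}^{\operatorname{Inc},d}=\bigoplus_{\pi\in\operatorname{Hom}_{\mathrm{OI}}(d,\mathbb{N})}\mathcal{P}\,\epsilon_\pi$ with action induced by $\tau\cdot(a\epsilon_\pi)=(\tau\cdot a)\epsilon_{\tau\circ\pi}$. A finitely generated free $\operatorname{Inc}$-module over $\mathcal{P}$ is one isomorphic to a finite direct sum $\bigoplus_{i=1}^r\mathcal{F}^{\operatorname{Inc},d_i}$. Gradings: $\mathcal{P}$ has the standard grading in which every variable has degree one. A graded $\operatorname{Inc}$-module is an $\operatorname{Inc}$-module with a $\mathbb{Z}$-grading making it a graded $\mathcal{P}$-module such that the action of $\operatorname{Inc}$ preserves degrees. *)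

(* Defs.v *)
From HB Require Import structures.
From mathcomp Require Import all_boot all_order all_algebra.
From mathcomp Require Import finmap boolp.
From mathcomp Require Import multinomials.monalg.

Set Implicit Arguments.
Unset Strict Implicit.
Unset Printing Implicit Defensive.

Import GRing.Theory.
Local Open Scope ring_scope.

(* Throughout, the index set {1, 2, ...} is represented by [nat] through the
   order isomorphism j |-> j - 1; Inc and Hom_OI(d, -) only involve its order. *)

Record inc := MkInc {
  inc_fun :> nat -> nat;
  inc_mono : forall i j, (i < j)%N -> (inc_fun i < inc_fun j)%N }.

Definition inc_id : inc := @MkInc (fun j => j) (fun i j h => h).

Definition inc_comp (s t : inc) : inc :=
  @MkInc (fun j => s (t j)) (fun i j h => inc_mono s (inc_mono t h)).

Definition homOI (d : nat) :=
  {p : {ffun 'I_d -> nat} | [forall i : 'I_d, forall j : 'I_d, (i < j)%N ==> (p i < p j)%N]}.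

Fact homOI_comp_subproof d (t : inc) (p : homOI d) :
  [forall i : 'I_d, forall j : 'I_d, (i < j)%N ==>
     ([ffun k => t (val p k)] i < [ffun k => t (val p k)] j)%N].
Proof.
apply/forallP => i; apply/forallP => j; apply/implyP => ij; rewrite !ffunE.
by apply: inc_mono; move/forallP: (valP p) => /(_ i)/forallP/(_ j)/implyP; apply.
Qed.

Definition homOI_comp d (t : inc) (p : homOI d) : homOI d :=
  Sub [ffun k => t (val p k)] (homOI_comp_subproof t p).

Definition noetherian_ring (K : comNzRingType) : Prop :=
  forall I : K -> Prop,
    I 0 -> (forall x y, I x -> I y -> I (x + y)) ->
    (forall a x, I x -> I (a * x)) ->
  exists2 s : seq K, (forall x, x \in s -> I x) &
    forall x, I x -> exists a : K -> K, x = \sum_(y <- s) a y * y.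

Notation incpoly K c := {malg K[{cmonom ('I_c * nat)%type}]}.

Section IncAction.
Variables (K : comNzRingType) (c : nat).
Local Notation P := (incpoly K c).

Definition incvar (i : 'I_c) (j : nat) : P := << ucm (i, j) >>.

Definition inc_mon (t : inc) (m : {cmonom ('I_c * nat)%type}) : P :=
  \prod_(v <- finsupp m) incvar v.1 (t v.2) ^+ m v.

Fact inc_mon_is_mmorphism t : mmorphism (inc_mon t).
Proof.
have E (d : {fset ('I_c * nat)%type}) (m : {cmonom ('I_c * nat)%type}) : (finsupp m `<=` d)%fset ->
    inc_mon t m = \prod_(v <- d) incvar v.1 (t v.2) ^+ m v.
  move=> md; rewrite /inc_mon; apply: big_fset_incl => // v _.
  by rewrite -cmE_eq0 => /eqP ->; rewrite expr0.
split=> [m n|]; last by rewrite /inc_mon mdom1 big_seq_fset0.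
rewrite (E _ m (fsubsetUl _ (finsupp n))) (E _ n (fsubsetUr (finsupp m) _)).
rewrite -big_split /= /inc_mon mdomD; apply: eq_bigr => v _.
by rewrite cmM exprD.
Qed.

HB.instance Definition _ t := isMultiplicative.Build _ _ (inc_mon t)
  (inc_mon_is_mmorphism t).

(* the K-algebra endomorphism x_(i, j) |-> x_(i, t j) *)
Definition inc_poly (t : inc) : P -> P := mmap malgC (inc_mon t).

Lemma inc_polyD t : {morph inc_poly t : a b / a + b}.
Proof. exact: (mmapD (f := malgC)). Qed.

Lemma inc_polyM t : {morph inc_poly t : a b / a * b}.
Proof. by case: (mmap_is_multiplicative (f := malgC) (h := inc_mon t)). Qed.

Lemma inc_poly1 t : inc_poly t 1 = 1.
Proof. by case: (mmap_is_multiplicative (f := malgC) (h := inc_mon t)). Qed.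

Lemma inc_polyX t n : {morph inc_poly t : a / a ^+ n}.
Proof.
move=> a; elim: n => [|n IH]; first by rewrite !expr0 inc_poly1.
by rewrite exprS inc_polyM IH -exprS.
Qed.

Lemma inc_poly0 t : inc_poly t 0 = 0.
Proof. exact: (mmap0 (f := malgC)). Qed.

Lemma inc_polyC t (a : K) : inc_poly t a%:MP = a%:MP.
Proof. by rewrite /inc_poly mmapC. Qed.

Lemma inc_poly_var t i j : inc_poly t (incvar i j) = incvar i (t j).
Proof.
rewrite /inc_poly mmapU -[X in X * _]/(1 : P) mul1r /inc_mon mdomU big_seq_fset1.
by rewrite cmUU expr1.
Qed.

Lemma inc_poly_comp s t a : inc_poly (inc_comp s t) a = inc_poly s (inc_poly t a).
Proof.
rewrite [X in _ = inc_poly s X]/inc_poly mmapE {1}/inc_poly mmapE.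
rewrite (big_morph _ (inc_polyD s) (inc_poly0 s)).
apply: eq_bigr => m _; rewrite inc_polyM inc_polyC; congr (_ * _).
rewrite /inc_mon (big_morph _ (inc_polyM s) (inc_poly1 s)).
by apply: eq_bigr => v _; rewrite inc_polyX inc_poly_var.
Qed.

Lemma inc_poly_id a : inc_poly inc_id a = a.
Proof.
pose mpow (v : 'I_c * nat) n := iter n (mmul (ucm v)) mone.
have U1 (m n : {cmonom ('I_c * nat)%type}) :
    (<< mmul m n >> : P) = << m >> * << n >>.
  by rewrite malgM_def fgmulUU mulr1.
have UX v n : (<< ucm v >> : P) ^+ n = << mpow v n >>.
  elim: n => [|n IH]; first by rewrite expr0.
  by rewrite exprS IH /mpow iterS U1.
have EX v n w : mpow v n w = ((v == w) * n)%N.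
  elim: n => [|n IH]; first by rewrite muln0 cm1.
  by rewrite /mpow iterS cmM IH cmU mulnS.
have E m : inc_mon inc_id m = << m >>.
  rewrite /inc_mon; under eq_bigr => v _ do
    rewrite /incvar -surjective_pairing UX.
  have -> (s : seq ('I_c * nat)) : \prod_(v <- s) (<< mpow v (m v) >> : P) =
      << \big[mmul/mone]_(v <- s) mpow v (m v) >>.
    elim: s => [|v s IH]; first by rewrite !big_nil.
    by rewrite !big_cons IH U1.
  suff -> : \big[mmul/mone]_(v <- finsupp m) mpow v (m v) = m by [].
  apply/eqP/cmP => w.
  have B (s : seq ('I_c * nat)) : (\big[mmul/mone]_(v <- s) mpow v (m v)) w
     = (\sum_(v <- s) (v == w) * m v)%N.
    by elim: s => [|v s IH]; rewrite ?big_nil ?cm1 // !big_cons cmM EX IH.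
  rewrite B; case: (boolP (w \in finsupp m)) => wm.
    rewrite (big_fsetD1 w) //= eqxx mul1n big_seq big1 ?addn0 // => v.
    by rewrite !inE => /andP[/negPf->].
  rewrite big_seq big1 => [|v vm].
    by apply/esym/eqP; rewrite cmE_eq0.
  by case: eqP vm wm => // -> ->.
rewrite /inc_poly mmapE [RHS]monalgE; apply: eq_bigr => m _.
by rewrite E malgM_def fgmulUU mul1m mulr1.
Qed.

End IncAction.

Record incModule (K : comNzRingType) (c : nat) := IncModule {
  inc_sort :> lmodType (incpoly K c);
  inc_act : inc -> inc_sort -> inc_sort;
  inc_act_id : forall q, inc_act inc_id q = q;
  inc_act_comp : forall s t q,
    inc_act (inc_comp s t) q = inc_act s (inc_act t q);
  inc_actD : forall t q1 q2, inc_act t (q1 + q2) = inc_act t q1 + inc_act t q2;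
  inc_actZ : forall t a q, inc_act t (a *: q) = inc_poly t a *: inc_act t q }.
Arguments inc_act {K c i} t q.

Record incHom K c (M N : incModule K c) := IncHom {
  inc_hom :> {linear M -> N};
  inc_hom_equiv : forall t q, inc_hom (inc_act t q) = inc_act t (inc_hom q) }.

Definition inc_iso K c (M N : incModule K c) : Prop :=
  exists f : incHom M N, bijective f.

Section Submodules.
Variables (K : comNzRingType) (c : nat) (L : incModule K c).

Record incSubmodule := IncSubmodule {
  in_sub :> L -> Prop;
  in_sub0 : in_sub 0;
  in_subD : forall x y, in_sub x -> in_sub y -> in_sub (x + y);
  in_subZ : forall a x, in_sub x -> in_sub (a *: x);
  in_sub_act : forall t x, in_sub x -> in_sub (inc_act t x) }.

Definition inc_fg : Prop :=
  exists s : seq L, forall N : incSubmodule,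
    (forall q, q \in s -> N q) -> forall q, N q.

Variable M : incSubmodule.

Definition sub_pred : {pred L} := fun x => `[< M x >].

Definition sub_car := {x : L | x \in sub_pred}.
HB.instance Definition _ := Choice.on sub_car.
HB.instance Definition _ := SubChoice.on sub_car.

Fact sub_pred_closed : subsemimod_closed sub_pred.
Proof.
split; first split.
- exact/asboolP/in_sub0.
- by move=> x y /asboolP Mx /asboolP My; apply/asboolP/in_subD.
- by move=> a x /asboolP Mx; apply/asboolP/in_subZ.
Qed.

HB.instance Definition _ :=
  GRing.SubChoice_isSubLmodule.Build _ L sub_pred sub_car sub_pred_closed.

Fact sub_act_subproof t (x : sub_car) : inc_act t (val x) \in sub_pred.
Proof. by apply/asboolP/in_sub_act; move: (valP x) => /asboolP. Qed.

Definition sub_act t (x : sub_car) : sub_car :=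
  exist _ (inc_act t (val x)) (sub_act_subproof t x).

Fact sub_act_id x : sub_act inc_id x = x.
Proof. by apply: val_inj; rewrite /= inc_act_id. Qed.

Fact sub_act_comp s t x : sub_act (inc_comp s t) x = sub_act s (sub_act t x).
Proof. by apply: val_inj; rewrite /= inc_act_comp. Qed.

Fact sub_actD t x y : sub_act t (x + y) = sub_act t x + sub_act t y.
Proof. by apply: val_inj; rewrite !raddfD /= inc_actD. Qed.

Fact sub_actZ t a x : sub_act t (a *: x) = inc_poly t a *: sub_act t x.
Proof. by apply: val_inj; rewrite !linearZ /= inc_actZ. Qed.

Definition incmod_of_sub : incModule K c :=
  @IncModule K c sub_car sub_act sub_act_id sub_act_comp sub_actD sub_actZ.

End Submodules.

Coercion incmod_of_sub : incSubmodule >-> incModule.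

(* The free P-module with basis (e_b)_(b : B), Inc acting through an action on
   the index set B by t (a e_b) = (t a) e_(t b). *)
Section FreeOn.
Variables (K : comNzRingType) (c : nat).
Local Notation P := (incpoly K c).
Variables (B : choiceType) (actB : inc -> B -> B).
Hypothesis actB_id : forall b, actB inc_id b = b.
Hypothesis actB_comp : forall s t b, actB (inc_comp s t) b = actB s (actB t b).

Definition free_act (t : inc) (u : {malg P[B]}) : {malg P[B]} :=
  \sum_(b <- msupp u) << inc_poly t u@_b *g actB t b >>.

Lemma free_actEw t (d : {fset B}) u : (msupp u `<=` d)%fset ->
  free_act t u = \sum_(b <- d) << inc_poly t u@_b *g actB t b >>.
Proof.
move=> ud; apply: big_fset_incl => // b _ /mcoeff_outdom ->.
by rewrite inc_poly0 monalgU0.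
Qed.

Lemma free_actU t a b : free_act t << a *g b >> = << inc_poly t a *g actB t b >>.
Proof. by rewrite (free_actEw _ msuppU_le) big_seq_fset1 mcoeffUU. Qed.

Fact free_actD t u v : free_act t (u + v) = free_act t u + free_act t v.
Proof.
rewrite (free_actEw _ (msuppD_le u v)) (free_actEw _ (fsubsetUl _ (msupp v))).
rewrite (free_actEw _ (fsubsetUr (msupp u) _)) -big_split /=.
by apply: eq_bigr => b _; rewrite mcoeffD inc_polyD monalgUD.
Qed.

Fact free_act0 t : free_act t 0 = 0.
Proof. by rewrite /free_act msupp0 big_seq_fset0. Qed.

Fact free_actZ t a u : free_act t (a *: u) = inc_poly t a *: free_act t u.
Proof.
rewrite (free_actEw _ (msuppZ_le a u)) /free_act scaler_sumr.
apply: eq_bigr => b _; apply/malgP => k.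
by rewrite mcoeffZ inc_polyM mcoeffZ !mcoeffU mulrnAr.
Qed.

Fact free_act_id u : free_act inc_id u = u.
Proof.
rewrite [RHS]monalgE; apply: eq_bigr => b _.
by rewrite inc_poly_id actB_id.
Qed.

Fact free_act_comp s t u :
  free_act (inc_comp s t) u = free_act s (free_act t u).
Proof.
rewrite [free_act t u]/free_act (big_morph _ (free_actD s) (free_act0 s)).
by apply: eq_bigr => b _; rewrite free_actU inc_poly_comp actB_comp.
Qed.

Definition inc_free_on : incModule K c :=
  IncModule free_act_id free_act_comp free_actD free_actZ.

End FreeOn.

Section FreeModules.
Variables (K : comNzRingType) (c : nat).

Fact homOI_comp_id d (p : homOI d) : homOI_comp inc_id p = p.
Proof. by apply/val_inj/ffunP => i; rewrite ffunE. Qed.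

Fact homOI_comp_comp d s t (p : homOI d) :
  homOI_comp (inc_comp s t) p = homOI_comp s (homOI_comp t p).
Proof. by apply/val_inj/ffunP => i; rewrite !ffunE. Qed.

Definition inc_free (d : nat) : incModule K c :=
  inc_free_on K c (@homOI_comp_id d) (@homOI_comp_comp d).

Definition inc_zero : incModule K c :=
  @inc_free_on K c void (fun _ b => b) (fun=> erefl) (fun _ _ => fun=> erefl).

Section DirectSum.
Variables M N : incModule K c.

Definition dsum_act t (q : M * N) := (inc_act t q.1, inc_act t q.2).

Fact dsum_act_id q : dsum_act inc_id q = q.
Proof. by case: q => x y; rewrite /dsum_act !inc_act_id. Qed.

Fact dsum_act_comp s t q :
  dsum_act (inc_comp s t) q = dsum_act s (dsum_act t q).
Proof. by rewrite /dsum_act !inc_act_comp. Qed.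

Fact dsum_actD t q1 q2 : dsum_act t (q1 + q2) = dsum_act t q1 + dsum_act t q2.
Proof. by rewrite /dsum_act !inc_actD. Qed.

Fact dsum_actZ t a q : dsum_act t (a *: q) = inc_poly t a *: dsum_act t q.
Proof. by rewrite /dsum_act !inc_actZ. Qed.

Definition inc_dsum : incModule K c :=
  @IncModule K c (M * N)%type dsum_act dsum_act_id dsum_act_comp
    dsum_actD dsum_actZ.

End DirectSum.

Definition inc_fg_free (M : incModule K c) : Prop :=
  exists ds : seq nat,
    inc_iso M (foldr (fun d N => inc_dsum (inc_free d) N) inc_zero ds).

End FreeModules.

Section Gradings.
Variables (K : comNzRingType) (c : nat).
Local Notation P := (incpoly K c).

Definition poly_homog (n : nat) (a : P) : Prop :=
  forall m, m \in msupp a -> mdeg m = n.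

Record incGrading (M : incModule K c) := IncGrading {
  piece :> int -> M -> Prop;
  piece0 : forall n, piece n 0;
  pieceB : forall n x y, piece n x -> piece n y -> piece n (x - y);
  (* M is the direct sum of the pieces *)
  piece_span : forall x, exists (s : seq int) (f : int -> M),
    (forall n, piece n (f n)) /\ x = \sum_(n <- s) f n;
  piece_indep : forall (s : seq int) (f : int -> M), uniq s ->
    (forall n, piece n (f n)) -> \sum_(n <- s) f n = 0 ->
    forall n, n \in s -> f n = 0;
  pieceZ : forall k n a x,
    poly_homog k a -> piece n x -> piece (k%:Z + n) (a *: x);
  piece_act : forall t n x, piece n x -> piece n (inc_act t x) }.

Definition degree_zero (M N : incModule K c) (gM : incGrading M)
    (gN : incGrading N) (f : M -> N) : Prop :=
  forall n x, gM n x -> gN n (f x).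

End Gradings.

Definition is_basis (R : nzRingType) (V : lmodType R) (B : V -> Prop) : Prop :=
  (forall x, exists (s : seq V) (a : V -> R),
     (forall b, b \in s -> B b) /\ x = \sum_(b <- s) a b *: b) /\
  (forall (s : seq V) (a : V -> R), uniq s -> (forall b, b \in s -> B b) ->
     \sum_(b <- s) a b *: b = 0 -> forall b, b \in s -> a b = 0).

(* free as a module over the polynomial ring, with no condition on Inc *)
Definition free_module K c (F : incModule K c) : Prop :=
  exists B : F -> Prop, is_basis B.

Definition graded_free_module K c (F : incModule K c) (g : incGrading F) :
    Prop :=
  exists2 B : F -> Prop, is_basis B & forall b, B b -> exists n, g n b.

(* F n is the module usually written F_(n+1), so the complex reads
   ... -> F 1 -> F 0 -> M -> 0. *)
Definition inc_exact K c (M : incModule K c) (F : nat -> incModule K c)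
    (e : incHom (F 0%N) M) (d : forall n, incHom (F n.+1) (F n)) : Prop :=
  [/\ forall y, exists x, e x = y,
      forall x, e x = 0 <-> exists y, d 0%N y = x
    & forall n x, d n x = 0 <-> exists y, d n.+1 y = x].

(* Main.v *)
Require Import Defs.
From HB Require Import structures.
From mathcomp Require Import all_boot all_order all_algebra.
From mathcomp Require Import finmap boolp.
From mathcomp Require Import multinomials.monalg.

(* The idea is to iterate one step: cover a finitely generated Inc-module M in
   which every element q has finite width d (tau q depends only on the values of
   tau below d).  Then q is the image of the generator of a morphism from the
   free module F^(Inc,d), so M is a quotient of a sum of r copies of F^(Inc,d),
   with d a common width of r (homogeneous, in the graded case) generators.  The
   kernel again has finite width, and it is finitely generated because this sum
   is Noetherian: its monomials m eps_(i, pi) are words over N^(c+d) together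
   with an index i < r, Higman's lemma makes divisibility up to Inc a
   well-quasi-order on them, and leading coefficients with respect to an
   Inc-compatible monomial well-order are controlled by the Noetherianity of K. *)

Set Implicit Arguments.
Unset Strict Implicit.
Unset Printing Implicit Defensive.

Import GRing.Theory.

(** * Well-quasi-orders *)

(** Finite width does not follow from finite generation: the free P-module with basis Inc, acted on
    by left composition, is generated by one element, but it is no quotient of a sum of modules
    F^(Inc,d), because equivariant images of elements of finite width have finite width. Over a ring
    K a leading term need not be cancelled by a single earlier one; a whole chain of earlier leading
    terms dividing it is used, so that its coefficient lies in the ideal of theirs. The monomial
    order compares two sequences of exponents at the highest position where they differ: an element
    of Inc moves positions monotonically and multiplication adds the same exponents to both, so this
    position is carried along. With finite supports such an order is well-founded in spite of the
    infinitely many variables. *)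

Definition inc_of_step (h : nat -> nat) (hS : forall n, h n < h n.+1) : inc :=
  @MkInc h (homo_ltn ltn_trans hS).

Lemma inc_le_mono (t : inc) i j : i <= j -> t i <= t j.
Proof. by rewrite leq_eqVlt => /predU1P[->//|/(inc_mono t)/ltnW]. Qed.

Lemma inc_lt_iff (t : inc) i j : (t i < t j) = (i < j).
Proof.
apply/idP/idP => [|/inc_mono //].
by rewrite !ltnNge; apply: contraNN => /inc_le_mono.
Qed.

Lemma inc_inj (t : inc) : injective t.
Proof.
move=> i j e; case: (ltngtP i j) => // /(inc_mono t); by rewrite e ltnn.
Qed.

(** An infinite monotone subsequence is asked for instead of one good pair: conjunctions then only
    need a subsequence of a subsequence, and the Groebner argument uses the whole chain. *)
Definition wqo (A : Type) (R : A -> A -> Prop) : Prop :=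
  forall f : nat -> A, exists g : inc,
    forall i j, i < j -> R (f (g i)) (f (g j)).

(** Indices without a later [R]-successor are bounded, since otherwise they would form a subsequence
    without a good pair. Beyond the bound, successors are iterated and transitivity makes the chain
    monotone. *)
Lemma wqo_of_good (A : Type) (R : A -> A -> Prop)
    (R_trans : forall y x z, R x y -> R y z -> R x z) :
  (forall f : nat -> A, exists i j, i < j /\ R (f i) (f j)) -> wqo R.
Proof.
move=> good f.
have [n hn] : exists n, forall i, n <= i -> exists2 j, i < j & R (f i) (f j).
  apply: contrapT => /forallNP no.
  have /choice [h hh] n : exists i, n <= i /\ forall j, i < j -> ~ R (f i) (f j).
    have /existsNP [i /not_implyP [ni hi]] := no n.
    by exists i; split=> // j ij Rij; apply: hi; exists j.
  pose k := fix k n := if n is m.+1 then h (k m).+1 else h 0.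
  have kS m : k m < k m.+1 by case: (hh (k m).+1).
  have [i [j [ij]]] := good (fun m => f (k m)).
  have kP m : forall j, k m < j -> ~ R (f (k m)) (f j).
    by case: m => [|m] /=; [have [] := hh 0 | have [] := hh (k m).+1].
  exact: (kP i _ (inc_mono (inc_of_step kS) ij)).
have /choice [h hh] i : exists j, n <= i -> i < j /\ R (f i) (f j).
  by case: (leqP n i) => [/hn [j ij Rij]|_]; [exists j | exists 0].
pose k m := iter m h n.
have nk m : n <= k m.
  by elim: m => // m nm; apply: (leq_trans nm); apply/ltnW; case: (hh _ nm).
have kS m : k m < k m.+1 by case: (hh _ (nk m)).
exists (inc_of_step kS) => i j ij /=.
apply: (homo_ltn (r := fun a b => R (f a) (f b)) (f := k)) ij => [y x z|m].
  exact: R_trans.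
by case: (hh _ (nk m)).
Qed.

Lemma wqo_sub (A : Type) (R S : A -> A -> Prop) :
  (forall x y, R x y -> S x y) -> wqo R -> wqo S.
Proof. by move=> RS wR f; have [g hg] := wR f; exists g => i j /hg /RS. Qed.

Lemma wqo_preim (A B : Type) (h : B -> A) (R : A -> A -> Prop) :
  wqo R -> wqo (fun x y => R (h x) (h y)).
Proof. by move=> wR f; exact: (wR (fun n => h (f n))). Qed.

Lemma wqo_and (A : Type) (R S : A -> A -> Prop) :
  wqo R -> wqo S -> wqo (fun x y => R x y /\ S x y).
Proof.
move=> wR wS f; have [g hg] := wR f; have [g' hg'] := wS (fun n => f (g n)).
exists (inc_comp g g') => i j ij /=; split; last exact: hg'.
by apply: hg; apply: inc_mono.
Qed.

Lemma wqo_leq : wqo leq.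
Proof.
apply: wqo_of_good => [y x z|f]; first exact: leq_trans.
apply: contrapT => /forallNP no.
have dec i j : i < j -> f j < f i.
  by move=> ij; rewrite ltnNge; apply/negP => le; apply: (no i); exists j.
have bound n : f n + n <= f 0.
  elim: n => [|n IH]; first by rewrite addn0.
  by rewrite addnS -addSn (leq_trans _ IH) // leq_add2r dec.
by have := bound (f 0).+1; rewrite addnS ltnNge leq_addl.
Qed.

(** Dickson's lemma, by induction on the number of coordinates. *)
Lemma wqo_pointwise n :
  wqo (fun a b : nat -> nat => forall k, k < n -> a k <= b k).
Proof.
elim: n => [|n IH]; first by move=> f; exists inc_id.
apply: wqo_sub (wqo_and IH (wqo_preim (fun a => a n) wqo_leq)).
move=> a b [ab abn] k; rewrite ltnS leq_eqVlt => /predU1P[->//|].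
exact: ab.
Qed.

(* A word is a length with a sequence of letters, of which only the letters
   below the length matter. *)
Definition word (A : Type) := (nat * (nat -> A))%type.

(** The embedding is a total element of Inc, not just a map between positions, so that it can later
    act on terms. *)
Definition word_emb (A : Type) (R : A -> A -> Prop) (u v : word A) : Prop :=
  exists t : inc, forall i, i < u.1 -> t i < v.1 /\ R (u.2 i) (v.2 (t i)).

Definition word_tail (A : Type) (u : word A) : word A :=
  (u.1.-1, fun i => u.2 i.+1).

Lemma word_emb_tail (A : Type) (R : A -> A -> Prop) (u v : word A) :
  0 < v.1 -> word_emb R u (word_tail v) -> word_emb R u v.
Proof.
case: v => [[//|n] v] /= _ [t tP].
exists (inc_of_step (h := fun i => (t i).+1) (fun n => inc_mono t (ltnSn n))).
by move=> i /tP.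
Qed.

Lemma word_emb_cons (A : Type) (R : A -> A -> Prop) (u v : word A) :
  0 < v.1 -> R (u.2 0) (v.2 0) -> word_emb R (word_tail u) (word_tail v) ->
  word_emb R u v.
Proof.
case: v => [[//|n] v] _ /= uv [t tP].
pose h i := if i is j.+1 then (t j).+1 else 0.
have hS i : h i < h i.+1 by case: i => // i; apply: (inc_mono t).
exists (inc_of_step hS) => -[|i] //= ui.
by apply: tP => /=; case: (u.1) ui.
Qed.

Lemma word_emb_trans (A : Type) (R : A -> A -> Prop)
    (R_trans : forall y x z, R x y -> R y z -> R x z) v u w :
  word_emb R u v -> word_emb R v w -> word_emb R u w.
Proof.
move=> [s sP] [t tP]; exists (inc_comp t s) => i /sP [/tP [lt Rt] Rs] /=.
by split=> //; apply: R_trans Rt.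
Qed.

(* Nash-Williams' minimal bad sequence argument. *)
Lemma higman (A : Type) (R : A -> A -> Prop)
    (R_trans : forall y x z, R x y -> R y z -> R x z) :
  wqo R -> wqo (word_emb R).
Proof.
move=> wR; apply: wqo_of_good; first exact: word_emb_trans.
pose bad (f : nat -> word A) := forall i j, i < j -> ~ word_emb R (f i) (f j).
suff nobad f : ~ bad f.
  move=> f; apply: contrapT => /forallNP no; apply: (nobad f) => i j ij e.
  by apply: (no i); exists j.
move=> badf.
pose ext (p : seq (word A)) := exists2 f, bad f & p = mkseq f (size p).
have ext0 : ext [::] by exists f.
(* [w] continues the prefix [p] of a bad sequence by a word of least length; [f 0] is a dummy value
   for a [p] that begins no bad sequence. *)
have step p : exists w : word A, ext p -> ext (rcons p w) /\
    forall w', ext (rcons p w') -> w.1 <= w'.1.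
  have [[h bh hp]|] := pselect (ext p); last by exists (f 0).
  pose Q n := `[< exists2 w : word A, ext (rcons p w) & w.1 = n >].
  have exQ : exists n, Q n.
    exists (h (size p)).1; apply/asboolP; exists (h (size p)) => //.
    by exists h; rewrite // size_rcons mkseqS -hp.
  case: (ex_minnP exQ) => n /asboolP [w ew <-] minw.
  by exists w => _; split=> // w' ew'; apply: minw; apply/asboolP; exists w'.
have [nxt nxtP] := choice step.
pose q n := iter n (fun p => rcons p (nxt p)) [::].
have extq n : ext (q n) by elim: n => //= n /nxtP [].
pose F n := nxt (q n).
have qE n : q n = mkseq F n by elim: n => //= n IH; rewrite mkseqS -IH.
have badF : bad F.
  move=> i j ij; have [h bh] := extq j.+1.
  rewrite qE size_mkseq => e.
  have hF k : k < j.+1 -> F k = h k.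
    by move=> kj; have /(congr1 (fun s => nth (f 0) s k)) := e; rewrite !nth_mkseq.
  by rewrite !hF ?ltnS ?(ltnW ij) //; apply: bh.
have Fpos n : 0 < (F n).1.
  rewrite lt0n; apply/eqP => e; apply: (badF n n.+1) => //.
  by exists inc_id => i; rewrite e.
have [g gP] := wR (fun n => (F n).2 0).
pose g0 := g 0.
(* The first [g0] words are kept, then come the tails along a subsequence with [R]-increasing first
   letters. A good pair here would give one in [F], yet the word at place [g0] is shorter than the
   minimal choice. *)
pose h i := if i < g0 then F i else word_tail (F (g (i - g0))).
have badh : bad h.
  move=> i j ij; rewrite /h; case: (ltnP j g0) => [jg|gj].
    by rewrite (ltn_trans ij jg); apply: badF.
  case: (ltnP i g0) => [ig|gi].
    move=> e; apply: (badF i (g (j - g0))); last exact: word_emb_tail e.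
    by apply: leq_trans ig _; apply: inc_le_mono.
  have lt : i - g0 < j - g0 by rewrite ltn_sub2r // (leq_ltn_trans gi).
  move=> e; apply: (badF (g (i - g0)) (g (j - g0))); first exact: inc_mono.
  by apply: word_emb_cons => //; apply: gP.
have eh : ext (rcons (q g0) (word_tail (F g0))).
  exists h; rewrite // size_rcons qE size_mkseq mkseqS.
  congr rcons; last by rewrite /h ltnn subnn.
  apply: (@eq_from_nth _ (f 0)); first by rewrite !size_mkseq.
  by rewrite size_mkseq => i ig; rewrite !nth_mkseq // /h ig.
have [_ /(_ _ eh)] := nxtP _ (extq g0).
by rewrite -/(F g0) /= leqNgt ltn_predL Fpos.
Qed.

(** * Comparison of sequences at their highest difference *)

Definition toplex (w w' : nat -> nat) : Prop :=
  exists2 p, w p < w' p & forall q, p < q -> w q = w' q.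

Lemma toplex_trans y x z : toplex x y -> toplex y z -> toplex x z.
Proof.
move=> [p xyp xyq] [q yzp yzq]; case: (ltngtP p q) => [pq|qp|pq].
- by exists q => [|i qi]; rewrite xyq // ?yzq // (ltn_trans pq).
- exists p => [|i pi]; first by rewrite -(yzq p).
  by rewrite xyq // yzq // (ltn_trans qp).
- by subst q; exists p => [|i pi]; [exact: ltn_trans yzp | rewrite xyq ?yzq].
Qed.

Lemma toplex_total (w w' : nat -> nat) n :
  (forall q, n <= q -> w q = w' q) ->
  [\/ toplex w w', w = w' | toplex w' w].
Proof.
move=> eqn; pose Q q := w q != w' q.
have Qn q : Q q -> q <= n.
  by rewrite leqNgt; apply: contraNN => /ltnW /eqn /eqP.
have [exQ|no] := pselect (exists q, Q q).
  case: (ex_maxnP exQ Qn) => p wp pmax.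
  have top q : p < q -> w q = w' q.
    by rewrite ltnNge => /negP pq; apply/eqP/negPn/negP => /pmax.
  case: (ltngtP (w p) (w' p)) => [lt|gt|e].
  - by apply: Or31; exists p.
  - by apply: Or33; exists p => // q /top.
  - by move: wp; rewrite /Q e eqxx.
apply: Or32; apply/funext => q; apply/eqP/negPn/negP => wq.
by apply: no; exists q.
Qed.

Definition toplex_below n (w w' : nat -> nat) : Prop :=
  exists p, [/\ p < n, w p < w' p & forall q, p < q < n -> w q = w' q].

(** A lexicographic product: the last coordinate is the most significant, so the induction is on its
    value and, while that value is fixed, on accessibility for the remaining coordinates. *)
Lemma toplex_below_wf n : well_founded (toplex_below n).
Proof.
elim: n => [|n IH] w; first by split=> v [p []].
have [a] := ubnP (w n); elim: a w => [w|a IHa w].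
  by rewrite ltn0.
rewrite ltnS leq_eqVlt => /predU1P[|]; last exact: IHa.
elim: {w}(IH w) => w _ IHw wa; split=> v [p [pn vp vq]].
have vwn : p = n \/ p < n /\ v n = w n.
  move: pn; rewrite ltnS leq_eqVlt => /predU1P[->|pn]; first by left.
  by right; split=> //; apply: vq; rewrite pn ltnSn.
case: vwn vp vq => [-> vp _|[{}pn e] vp vq].
  by apply: IHa; rewrite -wa.
apply: IHw; last by rewrite e.
by exists p; split=> // q /andP[pq qn]; apply: vq; rewrite pq ltnS ltnW.
Qed.

(** If a sequence vanishes from [n] on, so does every smaller one, as their top difference lies
    below [n]. Descents thus stay within the first [n] coordinates. *)
Lemma toplex_wf (X : Type) (W : X -> nat -> nat) :
  (forall x, exists n, forall q, n <= q -> W x q = 0) ->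
  well_founded (fun x y => toplex (W x) (W y)).
Proof.
move=> fin x; have [n xn] := fin x.
move e : (W x) xn => w; elim: {w}(toplex_below_wf n w) x e => w _ IH x e wn.
split=> y; rewrite e => -[p yxp yxq].
have pn : p < n by rewrite ltnNge; apply/negP => /wn wp; rewrite wp in yxp.
apply: (IH (W y)) => // [|q nq].
  by exists p; split=> // q /andP[pq _]; apply: yxq.
by rewrite yxq ?wn // (leq_trans pn).
Qed.

Local Open Scope ring_scope.

(** * Equivariant Groebner bases *)

Lemma wf_min (T : Type) (lt : T -> T -> Prop) (P : T -> Prop) :
  well_founded lt -> (exists x, P x) ->
  exists2 x, P x & forall y, P y -> ~ lt y x.
Proof.
move=> wf [x Px]; elim: {x}(wf x) Px => x _ IH Px.
have [[y Py yx]|no] := pselect (exists2 y, P y & lt y x); first exact: (IH y).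
by exists x => // y Py yx; apply: no; exists y.
Qed.

Section GroebnerNoetherianity.
Variables (K : comNzRingType) (c : nat) (hK : noetherian_ring K).
Variables (N : incModule K c) (X : eqType) (lt : X -> X -> Prop).
Hypothesis lt_wf : well_founded lt.
Hypothesis lt_trans : forall y x z, lt x y -> lt y z -> lt x z.
Hypothesis lt_total : forall x y, [\/ lt x y, x = y | lt y x].
(** Coordinates are assumed instead of a basis: [N] will be a submodule of a free module, which
    inherits the coordinates of the ambient module but not its basis. *)
Variable cf : X -> {additive N -> K}.
Hypothesis cfZ : forall x k u, cf x (k%:MP *: u) = k * cf x u.
Hypothesis cf_fin : forall u, exists s : seq X, forall x, cf x u <> 0 -> x \in s.
Hypothesis cf_eq0 : forall u, (forall x, cf x u = 0) -> u = 0.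

Definition bounded_by (u : N) (x : X) : Prop :=
  forall z, cf z u <> 0 -> z = x \/ lt z x.

Variable div : X -> X -> Prop.
Hypothesis div_wqo : wqo div.
(** One pair [(a, t)] serves all [u] bounded by [x] and transports the coefficient unchanged, so a
    relation over [K] between leading coefficients becomes a cancellation of leading terms. *)
Hypothesis divP : forall x y, div x y -> exists (a : incpoly K c) (t : inc),
  forall u, bounded_by u x ->
    cf y (a *: inc_act t u) = cf x u /\ bounded_by (a *: inc_act t u) y.

Let lead (u : N) (x : X) := cf x u <> 0 /\ bounded_by u x.

Let lead_exists u : u <> 0 -> exists x, lead u x.
Proof.
move=> u0; have [s sP] := cf_fin u.
have [x xs ux] : exists2 x, x \in s & cf x u <> 0.
  apply: contrapT => no; apply: u0; apply: cf_eq0 => x; apply: contrapT => ux.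
  by apply: no; exists x => //; apply: sP.
have {x xs ux} [y [uy yP]] : exists y, cf y u <> 0 /\
    forall z, z \in s -> cf z u <> 0 -> z = y \/ lt z y.
  elim: {sP} s x xs ux => // w s IH x.
  have [[y [uy yP]]|no] := pselect (exists y, cf y u <> 0 /\
      forall z, z \in s -> cf z u <> 0 -> z = y \/ lt z y).
    have [uw|uw] := pselect (cf w u = 0).
      by exists y; split=> // z; rewrite inE => /predU1P[->//|]; apply: yP.
    have [wy|wy|yw] := lt_total w y.
    - exists y; split=> // z; rewrite inE => /predU1P[-> _|]; first by right.
      exact: yP.
    - exists y; split=> // z; rewrite inE => /predU1P[-> _|]; first by left.
      exact: yP.
    - exists w; split=> // z; rewrite inE => /predU1P[-> _|zs uz]; first by left.
      by right; have [->//|/lt_trans] := yP z zs uz; apply.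
  have out z : z \in s -> cf z u = 0.
    by move=> zs; apply: contrapT => uz; apply: no; apply: (IH z).
  rewrite inE => /predU1P[-> uw|/out //].
  by exists w; split=> // z; rewrite inE => /predU1P[->|/out //]; left.
by exists y; split=> // z uz; apply: yP => //; apply: sP.
Qed.

(* If N is not finitely generated, pick successively an element outside the
   span of the previous ones with minimal leading term.  Along a subsequence
   whose leading terms form a div-chain, some leading coefficient is a
   combination of the earlier ones, and cancelling it contradicts minimality. *)
Lemma groebner_noetherianity : inc_fg N.
Proof.
apply: contrapT => /forallNP nofg.
pose sp (s : seq N) q := forall N' : incSubmodule N,
  (forall p, p \in s -> N' p) -> N' q.
have step s : exists qx : N * X, [/\ ~ sp s qx.1, lead qx.1 qx.2 &
    forall q x, ~ sp s q -> lead q x -> ~ lt x qx.2].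
  have [q nq] : exists q, ~ sp s q.
    apply: contrapT => /forallNP no; apply: (nofg s) => N' sN' q.
    by have /contrapT := no q; apply.
  have [|x [p np px] xmin] := @wf_min _ _
      (fun x => exists2 q, ~ sp s q & lead q x) lt_wf.
    have [|x qx] := @lead_exists q; last by exists x; exists q.
    by move=> q0; apply: nq => N' _; rewrite q0; apply: in_sub0.
  exists (p, x); split=> //= r y nr ry; apply: xmin; by exists r.
have [nx nxP] := choice step.
pose S n := iter n (fun s => rcons s (nx s).1) [::].
pose f n := (nx (S n)).1; pose x n := (nx (S n)).2.
have SE n : S n = mkseq f n by elim: n => //= n IH; rewrite mkseqS -IH.
have [g gP] := div_wqo x.
pose a n := cf (x (g n)) (f (g n)).
(* The ideal generated by the first [n] leading coefficients of the chain. *)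
pose J n r := exists b : nat -> K, r = \sum_(i < n) b i * a i.
have Jle m n r : (m <= n)%N -> J m r -> J n r.
  move=> mn [b ->]; exists (fun i => if (i < m)%N then b i else 0).
  rewrite (big_ord_widen n (fun i => b i * a i) mn) [LHS]big_mkcond /=.
  by apply: eq_bigr => i _; case: ifP => //; rewrite mul0r.
have J0 n : J n 0.
  by exists (fun=> 0); rewrite big1 // => i _; rewrite mul0r.
have JD n r s : J n r -> J n s -> J n (r + s).
  move=> [b ->] [b' ->]; exists (fun i => b i + b' i).
  by rewrite -big_split; apply: eq_bigr => i _; rewrite mulrDl.
have JZ n k r : J n r -> J n (k * r).
  move=> [b ->]; exists (fun i => k * b i).
  by rewrite big_distrr; apply: eq_bigr => i _; rewrite /= mulrA.
have [s sJ sgen] : exists2 s : seq K, (forall r, r \in s -> exists n, J n r) &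
    forall r, (exists n, J n r) -> exists b : K -> K, r = \sum_(y <- s) b y * y.
  apply: (hK (I := fun r => exists n, J n r)).
  - by exists 0%N.
  - move=> r t [m Jr] [n Jt]; exists (maxn m n); apply: JD.
      by apply: Jle Jr; apply: leq_maxl.
    by apply: Jle Jt; apply: leq_maxr.
  - by move=> k r [n Jr]; exists n; apply: JZ.
(* The ascending union of the [J n] is finitely generated, so a single [J n] contains all its
   generators. *)
have [n nJ] : exists n, forall r, r \in s -> J n r.
  elim: s sJ {sgen} => [|y s IH] sJ; first by exists 0%N.
  have [|n nJ] := IH; first by move=> r rs; apply: sJ; rewrite inE rs orbT.
  have [m mJ] := sJ y (mem_head _ _).
  exists (maxn m n) => r; rewrite inE => /predU1P[->|/nJ].
    by apply: Jle mJ; apply: leq_maxl.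
  by apply: Jle; apply: leq_maxr.
have [b ab] : J n (a n).
  have [|b ->] := sgen (a n).
    exists n.+1; exists (fun i => (i == n)%:R).
    rewrite (bigD1 ord_max) //= eqxx mul1r big1 ?addr0 // => i.
    by rewrite -val_eqE /= => /negPf ->; rewrite mul0r.
  elim: (s) nJ => [|y s' IH] nJ; first by rewrite big_nil; apply: J0.
  rewrite big_cons; apply: JD; first by apply: JZ; apply: nJ; apply: mem_head.
  by apply: IH => r rs; apply: nJ; rewrite inE rs orbT.
have [npn leadn minn] := nxP (S (g n)).
have /choice [op opP] (i : 'I_n) : exists op : incpoly K c * inc,
    cf (x (g n)) (op.1 *: inc_act op.2 (f (g i))) = a i /\
    bounded_by (op.1 *: inc_act op.2 (f (g i))) (x (g n)).
  have [k [t kt]] := divP (gP _ _ (ltn_ord i)).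
  by exists (k, t); apply: kt; have [_ []] := nxP (S (g i)).
(* The earlier leading terms are moved onto [x (g n)] and combined with the coefficients of the
   relation for [a n]. Subtracting this cancels the leading term of [f (g n)] but changes it only by
   an element of the earlier span. *)
pose h i := (b (val i))%:MP *: ((op i).1 *: inc_act (op i).2 (f (g (val i)))).
pose p := f (g n) - \sum_i h i.
have np : ~ sp (S (g n)) p.
  move=> pS; apply: npn => N' sN'; rewrite -/(f (g n)).
  rewrite -(subrK (\sum_i h i) (f (g n))).
  apply: in_subD; first exact: pS.
  apply: big_ind; [exact: in_sub0 | by move=> *; apply: in_subD |].
  move=> i _; do 2!apply: in_subZ; apply: in_sub_act; apply: sN'.
  rewrite SE; apply/(nthP 0); exists (g i); last by rewrite nth_mkseq // inc_lt_iff.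
  by rewrite size_mkseq inc_lt_iff.
have [|y [py yP]] := @lead_exists p.
  by move=> p0; apply: np => N' _; rewrite p0; apply: in_sub0.
apply: (minn p y np) => //.
have hb i z : cf z (h i) <> 0 -> z = x (g n) \/ lt z (x (g n)).
  rewrite cfZ => hz; apply: (opP i).2 => e; apply: hz; by rewrite e mulr0.
have [yx|//] : y = x (g n) \/ lt y (x (g n)).
  apply: contrapT => no; apply: py; rewrite raddfB raddf_sum /= big1.
    rewrite subr0; apply: contrapT => /leadn.2; exact: no.
  by move=> i _; apply: contrapT => /hb.
case: py; rewrite yx raddfB raddf_sum /= -/(a n) ab; apply/eqP; rewrite subr_eq0.
by apply/eqP/eq_bigr => i _; rewrite cfZ (opP i).1.
Qed.

End GroebnerNoetherianity.

(** * Monomials of P and coefficients in free modules *)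

Section IncMonomials.
Variables (K : comNzRingType) (c : nat).
Local Notation P := (incpoly K c).
Local Notation mon := {cmonom ('I_c * nat)%type}.

Definition cm_pow (v : 'I_c * nat) (n : nat) : mon :=
  iter n (mmul (ucm v)) mone.

Lemma cm_powE v n w : cm_pow v n w = ((v == w) * n)%N.
Proof.
elim: n => [|n IH]; first by rewrite muln0 cm1.
by rewrite /cm_pow iterS cmM IH cmU mulnS.
Qed.

Lemma mdeg_cm_pow v n : mdeg (cm_pow v n) = n.
Proof.
elim: n => [|n IH]; first exact: mdeg1.
by rewrite /cm_pow iterS mdegM mdegU IH.
Qed.

Lemma malgU1M (m n : mon) : (<< mmul m n >> : P) = << m >> * << n >>.
Proof. by rewrite malgM_def fgmulUU mulr1. Qed.

Lemma malgU_cm_pow v n : (<< ucm v >> : P) ^+ n = << cm_pow v n >>.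
Proof.
elim: n => [|n IH]; first by rewrite expr0.
by rewrite exprS IH /cm_pow iterS malgU1M.
Qed.

(* The monomial t . m, that is, [inc_mon t m] without coefficients. *)
Definition inc_cm (t : inc) (m : mon) : mon :=
  \big[mmul/mone]_(v <- finsupp m) cm_pow (v.1, t v.2) (m v).

Lemma inc_monE t m : inc_mon K t m = << inc_cm t m >>.
Proof.
rewrite /inc_mon /inc_cm; under eq_bigr do rewrite malgU_cm_pow.
elim: (enum_fset _) => [|v s IH]; first by rewrite !big_nil.
by rewrite !big_cons IH malgU1M.
Qed.

Lemma inc_cm_sum t m w :
  inc_cm t m w = (\sum_(v <- finsupp m) ((v.1, t v.2) == w) * m v)%N.
Proof.
rewrite /inc_cm; elim: (enum_fset _) => [|v s IH].
  by rewrite !big_nil cm1.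
by rewrite !big_cons cmM IH cm_powE.
Qed.

Lemma inc_cm_out (t : inc) m (k : 'I_c) l :
  (forall j, t j <> l) -> inc_cm t m (k, l) = 0%N.
Proof.
move=> tl; rewrite inc_cm_sum big1 // => v _.
by case: eqP => // -[_ /tl].
Qed.

Lemma inc_cmE t m (k : 'I_c) j : inc_cm t m (k, t j) = m (k, j).
Proof.
have eqt v : ((v.1, t v.2) == (k, t j)) = (v == (k, j)).
  by case: v => k' i; rewrite /= -!pair_eqE /= (inj_eq (@inc_inj t)).
rewrite inc_cm_sum; under eq_bigr do rewrite eqt.
case: (boolP ((k, j) \in finsupp m)) => [vm|].
  rewrite (big_fsetD1 (k, j)) //= eqxx mul1n big_seq big1 ?addn0 // => v.
  by rewrite !inE => /andP[/negPf->].
rewrite -cmE_eq0 => /eqP m0; rewrite m0 big1 // => v _.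
by case: eqP => // ->; rewrite m0.
Qed.

Lemma mdeg_inc_cm t m : mdeg (inc_cm t m) = mdeg m.
Proof.
rewrite /inc_cm (big_morph _ (@mdegM _) (@mdeg1 _)) (mdegE m).
by apply: eq_bigr => v _; rewrite mdeg_cm_pow.
Qed.

Lemma inc_cm_inj t : injective (inc_cm t).
Proof.
move=> m n e; apply/eqP/cmP => -[k j].
by rewrite -(inc_cmE t m) -(inc_cmE t n) e.
Qed.

Lemma mmulI (m : mon) : injective (mmul m).
Proof.
move=> n n' e; apply/eqP/cmP => v; have := congr1 (fun m : mon => m v) e.
by rewrite !cmM => /addnI.
Qed.

Lemma inc_polyU t (a : K) (m : mon) :
  inc_poly t << a *g m >> = << a *g inc_cm t m >>.
Proof. by rewrite /inc_poly mmapU inc_monE malgM_def fgmulUU mulr1 mul1m. Qed.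

End IncMonomials.

Section FreeCoefficients.
Variables (K : comNzRingType) (c : nat).
Local Notation P := (incpoly K c).
Local Notation mon := {cmonom ('I_c * nat)%type}.
Variables (B : choiceType) (actB : inc -> B -> B).
Hypothesis actB_id : forall b, actB inc_id b = b.
Hypothesis actB_comp : forall s t b, actB (inc_comp s t) b = actB s (actB t b).
Local Notation F := (inc_free_on K c actB_id actB_comp).

Lemma malgZU (R : nzRingType) (T : choiceType) (a b : R) (x : T) :
  a *: << b *g x >> = << a * b *g x >> :> {malg R[T]}.
Proof. by apply/malgP => k; rewrite mcoeffZ !mcoeffU mulrnAr. Qed.

Definition free_term (k : K) (x : B * mon) : F :=
  << (<< k *g x.2 >> : P) *g x.1 >>.

Lemma free_ind (Q : F -> Prop) :
  Q 0 -> (forall u v, Q u -> Q v -> Q (u + v)) ->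
  (forall k x, Q (free_term k x)) -> forall u, Q u.
Proof.
move=> Q0 QD QU u; rewrite (monalgE u); apply: big_ind => // b _.
rewrite (monalgE u@_b) raddf_sum; apply: big_ind => // m _.
exact: QU (b, m).
Qed.

(** Only additivity is required, because the maps compared later involve the action of Inc, which is
    semilinear over P. *)
Lemma free_ext (V : zmodType) (f g : F -> V) :
  {morph f : u v / u + v} -> {morph g : u v / u + v} ->
  (forall k x, f (free_term k x) = g (free_term k x)) -> f =1 g.
Proof.
have mor0 (h : F -> V) : {morph h : u v / u + v} -> h 0 = 0.
  by move=> hD; apply: (addIr (h 0)); rewrite -hD !add0r.
move=> fD gD fg; apply: free_ind => // [|u v fgu fgv]; first by rewrite !mor0.
by rewrite fD gD fgu fgv.
Qed.

Definition free_coef (x : B * mon) : {additive F -> K} :=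
  (mcoeff x.2 : {malg K[mon]} -> K) \o (mcoeff x.1 : {malg P[B]} -> P).

Lemma free_coefD x u v : free_coef x (u + v) = free_coef x u + free_coef x v.
Proof. exact: raddfD. Qed.

Lemma free_coefU x k y : free_coef x (free_term k y) = k *+ (y == x).
Proof.
case: x y => [b m] [b' m'].
by rewrite /= mcoeffU mcoeffMn mcoeffU -mulrnA mulnb andbC.
Qed.

Lemma free_coefZ x k u : free_coef x (k%:MP *: u) = k * free_coef x u.
Proof. by rewrite /= mcoeffZ mcoeffCM. Qed.

Lemma free_coef_fin u :
  exists s : seq (B * mon), forall x, free_coef x u <> 0 -> x \in s.
Proof.
move: u; apply: free_ind => [|u v [s sP] [s' s'P]|k y].
- by exists [::] => x; rewrite raddf0.
- exists (s ++ s') => x; rewrite free_coefD mem_cat => uv.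
  have [u0|/sP-> //] := pselect (free_coef x u = 0).
  by rewrite s'P ?orbT // => v0; apply: uv; rewrite u0 v0 addr0.
- exists [:: y] => x; rewrite free_coefU inE eq_sym.
  by case: eqP.
Qed.

Lemma free_coef_eq0 u : (forall x, free_coef x u = 0) -> u = 0.
Proof.
move=> u0; apply/malgP => b; apply/malgP => m; rewrite !mcoeff0.
exact: u0 (b, m).
Qed.

Definition act_term (m : mon) (t : inc) (x : B * mon) : B * mon :=
  (actB t x.1, mmul m (inc_cm t x.2)).

Definition term_op (m : mon) (t : inc) (u : F) : F := (<< m >> : P) *: inc_act t u.

Lemma term_opD m t u v : term_op m t (u + v) = term_op m t u + term_op m t v.
Proof. by rewrite /term_op inc_actD scalerDr. Qed.

Lemma term_opU m t k x :
  term_op m t (free_term k x) = free_term k (act_term m t x).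
Proof.
rewrite /term_op /free_term /= free_actU inc_polyU malgZU.
by rewrite malgM_def fgmulUU mul1r.
Qed.

Lemma free_coef_opD m t y :
  {morph (fun u => free_coef y (term_op m t u)) : u v / u + v}.
Proof. by move=> u v; cbv beta; rewrite term_opD free_coefD. Qed.

Lemma free_coef_op_out m t u y : (forall x, act_term m t x <> y) ->
  free_coef y (term_op m t u) = 0.
Proof.
move=> no; apply: (free_ext (@free_coef_opD m t y) (g := fun=> 0)) => [? ?|k x].
  by rewrite addr0.
by rewrite term_opU free_coefU (introF eqP (no x)) mulr0n.
Qed.

Hypothesis actB_inj : forall t, injective (actB t).

Lemma act_term_inj m t : injective (act_term m t).
Proof. by move=> [b n] [b' n'] [/actB_inj -> /mmulI/inc_cm_inj ->]. Qed.

(** Since [act_term m t] is injective, no two terms of [u] are merged and each coefficient moves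
    intact. *)
Lemma free_coef_op m t u x :
  free_coef (act_term m t x) (term_op m t u) = free_coef x u.
Proof.
move: u; apply: (free_ext (@free_coef_opD m t _)) => [u v|k y].
  exact: free_coefD.
by rewrite term_opU !free_coefU (inj_eq (@act_term_inj _ _)).
Qed.

End FreeCoefficients.

(** * Words, monomial order and divisibility in powers of F^(Inc,d) *)

Section FreePower.
Variables (K : comNzRingType) (c r d : nat).
Local Notation mon := {cmonom ('I_c * nat)%type}.
Local Notation B := ('I_r * homOI d)%type.

Definition pow_act (t : inc) (b : B) : B := (b.1, homOI_comp t b.2).

Fact pow_act_id b : pow_act inc_id b = b.
Proof. by case: b => i p; rewrite /pow_act homOI_comp_id. Qed.

Fact pow_act_comp s t b : pow_act (inc_comp s t) b = pow_act s (pow_act t b).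
Proof. by rewrite /pow_act homOI_comp_comp. Qed.

Lemma homOI_compE t (p : homOI d) l : val (homOI_comp t p) l = t (val p l).
Proof. by rewrite ffunE. Qed.

Lemma homOI_eq (p q : homOI d) : (forall l, val p l = val q l) -> p = q.
Proof. by move=> pq; apply/val_inj/ffunP. Qed.

Lemma pow_act_inj t : injective (pow_act t).
Proof.
move=> [i p] [j q] [-> e]; congr (_, _); apply: homOI_eq => l.
by apply: (@inc_inj t); rewrite -!homOI_compE /homOI_comp /= e.
Qed.

(* The direct sum of r copies of [inc_free K c d]. *)
Definition inc_pow : incModule K c := inc_free_on K c pow_act_id pow_act_comp.

Local Open Scope nat_scope.

(* The letter at position j of the basis element m eps_(i, p) records the
   exponents of the x_(k, j), then which l satisfy p l = j. *)
Definition letter (x : B * mon) (j s : nat) : nat :=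
  if insub s : option 'I_c is Some k then x.2 (k, j) else
  if insub (s - c) : option 'I_d is Some l then val x.1.2 l == j else 0.

Lemma letter_exponent x j (k : 'I_c) : letter x j k = x.2 (k, j).
Proof. by rewrite /letter valK. Qed.

Lemma letter_mark x j (l : 'I_d) : letter x j (c + l) = (val x.1.2 l == j).
Proof. by rewrite /letter insubN ?addKn ?valK // -leqNgt leq_addr. Qed.

Lemma letter_inj x y : x.1.1 = y.1.1 ->
  (forall j s, s < c + d -> letter x j s = letter y j s) -> x = y.
Proof.
case: x y => [[i p] m] [[i' p'] m'] /= -> eq_letter.
have -> : m = m'.
  apply/eqP/cmP => -[k j]; have := eq_letter j k.
  by rewrite !letter_exponent ltn_addr //; apply.
congr (_, _, _); apply: homOI_eq => l; have := eq_letter (val p l) (c + l).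
by rewrite !letter_mark ltn_add2l ltn_ord eqxx => /(_ isT); case: eqP.
Qed.

Definition word_len (x : B * mon) : nat :=
  maxn (\max_(v <- finsupp x.2) v.2.+1) (\max_l (val x.1.2 l).+1).

Lemma letter_out x j s : word_len x <= j -> letter x j s = 0.
Proof.
rewrite geq_max => /andP[mj pj]; rewrite /letter; case: insub => [k|].
  apply/eqP; rewrite cmE_eq0; apply/negP => kj.
  have := leq_bigmax_seq (r := enum_fset (finsupp x.2)) (P := xpredT)
    (F := fun v => v.2.+1) _ kj isT.
  by move/leq_trans => /(_ _ mj); rewrite ltnn.
case: insub => // l; case: eqP => // lj.
have := leq_bigmax (F := fun l => (val x.1.2 l).+1) l.
by move/leq_trans => /(_ _ pj); rewrite lj ltnn.
Qed.

Lemma mark_lt_word_len (x : B * mon) (l : 'I_d) : val x.1.2 l < word_len x.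
Proof.
rewrite ltnNge; apply/negP => /(letter_out (c + l)).
by rewrite letter_mark eqxx.
Qed.

Definition exponent_letter (m : mon) (j s : nat) : nat :=
  if insub s : option 'I_c is Some k then m (k, j) else 0.

Local Notation act_term := (act_term pow_act).

Lemma letter_act m t x j s :
  letter (act_term m t x) (t j) s = exponent_letter m (t j) s + letter x j s.
Proof.
rewrite /letter /exponent_letter /=; case: insub => [k|].
  by rewrite cmM inc_cmE.
by case: insub => // l; rewrite ffunE (inj_eq (@inc_inj t)).
Qed.

Lemma letter_act_out m (t : inc) x l s : (forall j, t j <> l) ->
  letter (act_term m t x) l s = exponent_letter m l s.
Proof.
move=> tl; rewrite /letter /exponent_letter /=; case: insub => [k|].
  by rewrite cmM inc_cm_out ?addn0.
by case: insub => // a; rewrite ffunE; case: eqP => // /tl.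
Qed.

(** Positivity of [c] keeps the block length [c + d] positive even when [d = 0], as the divisions in
    [code] require. *)
Hypothesis hc : 0 < c.
Local Notation e := (c + d).

Let e_gt0 : 0 < e. Proof. exact: ltn_addr. Qed.

Let block_div a s : s < e -> (a * e + s) %/ e = a.
Proof. by move=> se; rewrite divnMDl // divn_small // addn0. Qed.

Let block_mod a s : s < e -> (a * e + s) %% e = s.
Proof. by move=> se; rewrite modnMDl modn_small. Qed.

(* The monomial order is [toplex] on codes, which flatten the word and put the
   index of the summand at the bottom. *)
Definition code (x : B * mon) (q : nat) : nat :=
  if q is q'.+1 then letter x (q' %/ e) (q' %% e) else x.1.1.

Lemma code_letter x j s : s < e -> code x (j * e + s).+1 = letter x j s.
Proof. by move=> se; rewrite /= block_div // block_mod. Qed.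

Lemma code_inj x y : code x = code y -> x = y.
Proof.
move=> exy; apply: letter_inj => [|j s se].
  by apply: val_inj; exact: (congr1 (fun f => f 0) exy).
by rewrite -!code_letter // exy.
Qed.

Lemma code_fin x : exists n, forall q, n <= q -> code x q = 0.
Proof.
exists (word_len x * e).+1 => -[//|q]; rewrite ltnS => lq.
by apply: letter_out; rewrite leq_divRL.
Qed.

Lemma blow_up_mono (t : inc) i j : i < j ->
  (if i is i'.+1 then (t (i' %/ e) * e + i' %% e).+1 else 0) <
  (if j is j'.+1 then (t (j' %/ e) * e + j' %% e).+1 else 0).
Proof.
case: i j => [|i] [|j] //; rewrite !ltnS => ij.
have := leq_div2r e (ltnW ij); rewrite leq_eqVlt => /predU1P[eij|lt_ij].
  by rewrite eij ltn_add2l -(ltn_add2l (i %/ e * e)) {2}eij -!divn_eq.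
apply: (@leq_trans ((t (i %/ e)).+1 * e)).
  by rewrite mulSn addnC ltn_add2r ltn_mod.
by apply: leq_trans (leq_addr _ _); rewrite leq_mul2r inc_mono // orbT.
Qed.

(* The effect of t on the positions of [code]. *)
Definition blow_up (t : inc) : inc := MkInc (blow_up_mono t).

Definition exponent_code (m : mon) (q : nat) : nat :=
  if q is q'.+1 then exponent_letter m (q' %/ e) (q' %% e) else 0.

Lemma code_act m t x q : code (act_term m t x) (blow_up t q) =
  exponent_code m (blow_up t q) + code x q.
Proof.
case: q => // q; rewrite /code /exponent_code /= block_div ?ltn_mod //.
by rewrite block_mod ?ltn_mod // letter_act.
Qed.

Lemma code_act_out m t x p : (forall q, blow_up t q <> p) ->
  code (act_term m t x) p = exponent_code m p.
Proof.
case: p => [/(_ 0) //|p] tp; apply: letter_act_out => j tj.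
apply: (tp (j * e + p %% e).+1) => /=.
by rewrite block_div ?block_mod ?ltn_mod // tj -divn_eq.
Qed.

(** Both codes gain the same summand on the image of [blow_up t] and equal [exponent_code m] outside
    it, so the top difference moves from [p] to [blow_up t p]. *)
Lemma toplex_act m t x y : toplex (code x) (code y) ->
  toplex (code (act_term m t x)) (code (act_term m t y)).
Proof.
move=> [p xyp xyq]; exists (blow_up t p) => [|q pq].
  by rewrite !code_act ltn_add2l.
have [[q' eq]|no] := pselect (exists q', blow_up t q' = q).
  by rewrite -eq !code_act xyq // -(inc_lt_iff (blow_up t)) eq.
by rewrite !code_act_out // => q' eq; apply: no; exists q'.
Qed.

(* The two inequalities state that the indices are equal, in a form that is a
   well-quasi-order by [wqo_leq]. *)
Definition term_div (x y : B * mon) : Prop :=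
  (x.1.1 <= y.1.1 /\ r - x.1.1 <= r - y.1.1) /\
  word_emb (fun a b => forall s, s < e -> a s <= b s)
    (word_len x, letter x) (word_len y, letter y).

Lemma term_div_wqo : wqo term_div.
Proof.
apply: wqo_and; first apply: wqo_and.
- exact: (wqo_preim (fun x : B * mon => val x.1.1) wqo_leq).
- exact: (wqo_preim (fun x : B * mon => r - x.1.1) wqo_leq).
- apply: (wqo_preim (fun x : B * mon => (word_len x, letter x) : word _)).
  apply: higman (wqo_pointwise _) => y x z xy yz s se.
  exact: leq_trans (xy s se) (yz s se).
Qed.

(** Marks are 0 or 1, so a mark of [x] at a position forces the same mark of [y] at its image under
    [t]; this identifies the two maps up to [t]. The inequalities between exponents make the
    quotient monomial [divcm] available. *)
Lemma term_divP x y : term_div x y -> exists m t, y = act_term m t x.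
Proof.
move=> [[le1 le2] [t /= tP]].
have exy : x.1.1 = y.1.1.
  apply/val_inj/anti_leq; rewrite le1 /=.
  by rewrite leq_sub2lE // in le2; apply/ltnW.
have pE l : val y.1.2 l = t (val x.1.2 l).
  have [_ /(_ (c + l))] := tP _ (mark_lt_word_len x l).
  by rewrite !letter_mark ltn_add2l ltn_ord eqxx => /(_ isT); case: eqP.
have mle k j : x.2 (k, j) <= y.2 (k, t j).
  have [/tP [_ /(_ k)]|/letter_out x0] := ltnP j (word_len x).
    by rewrite !letter_exponent ltn_addr //; apply.
  by rewrite -letter_exponent x0.
exists (divcm y.2 (inc_cm t x.2)), t.
case: x y exy pE mle {tP le1 le2} => [[i p] m] [[i' p'] m'] /= -> pE mle.
congr (_, _, _).
  by apply: homOI_eq => l; rewrite homOI_compE.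
apply/eqP/cmP => -[k l]; rewrite cmM divcmE subnK //.
have [[j <-]|no] := pselect (exists j, t j = l); first by rewrite inc_cmE.
by rewrite inc_cm_out // => j tj; apply: no; exists j.
Qed.

Local Open Scope ring_scope.

Local Notation pow_coef := (@free_coef K c _ pow_act pow_act_id pow_act_comp).

(** Coefficients are pulled back along the injection, so submodules of the power, which are modules
    of a different type, are covered. *)
Lemma inc_fg_into_pow (hK : noetherian_ring K) (N : incModule K c)
    (f : incHom N inc_pow) : injective f -> inc_fg N.
Proof.
move=> f_inj.
pose cf x : {additive N -> K} := pow_coef x \o f.
have cfE x u : cf x u = pow_coef x (f u) by [].
apply: (@groebner_noetherianity K c hK N _
  (fun x y => toplex (code x) (code y)) _ _ _ cf _ _ _ term_div term_div_wqo).
- exact: toplex_wf code_fin.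
- by move=> y x z; apply: toplex_trans.
- move=> x y; have [n xn] := code_fin x; have [m ym] := code_fin y.
  have [|xy|/code_inj xy|yx] := @toplex_total (code x) (code y) (maxn n m).
  + by move=> q; rewrite geq_max => /andP[nq mq]; rewrite xn ?ym.
  + exact: Or31.
  + exact: Or32.
  + exact: Or33.
- by move=> x k u; rewrite !cfE linearZ; apply: free_coefZ.
- by move=> u; exact: (free_coef_fin (f u)).
- move=> u u0; apply: f_inj; rewrite raddf0; exact: free_coef_eq0 u0.
move=> x y /term_divP [m [t ->]]; exists << m >>, t => u ux.
have cf_op z : cf z (<< m >> *: inc_act t u) =
    pow_coef z (term_op m t (f u)).
  by rewrite cfE linearZ inc_hom_equiv.
split; first by rewrite cf_op; apply: free_coef_op; apply: pow_act_inj.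
move=> z; rewrite cf_op => uz.
(* A term of the moved element comes from a term [w] of [u], and [toplex_act] carries the bound on
   [w] over to its image. *)
have [[w zw]|no] := pselect (exists w, act_term m t w = z); last first.
  by case: uz; apply: free_coef_op_out => w zw; apply: no; exists w.
have uw : cf w u <> 0.
  move=> w0; apply: uz; rewrite -zw -w0; apply: free_coef_op; apply: pow_act_inj.
have [wx|wx] := ux w uw; first by left; rewrite -zw wx.
by right; rewrite -zw; apply: toplex_act.
Qed.

End FreePower.

(** * Finite generation and finite width *)

Section IncModules.
Variables (K : comNzRingType) (c : nat).
Implicit Types L M N : incModule K c.

Lemma inc_act0 M t : inc_act t 0 = 0 :> M.
Proof. by apply: (addIr (inc_act t 0)); rewrite -inc_actD !add0r. Qed.

Lemma in_sub_sum M (S : incSubmodule M) (I : Type) (s : seq I) (P : pred I)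
    (f : I -> M) :
  (forall i, P i -> S (f i)) -> S (\sum_(i <- s | P i) f i).
Proof. by move=> Sf; apply: big_ind => //; [exact: in_sub0 | exact: in_subD]. Qed.

Definition sub_incl L (S : incSubmodule L) : incHom S L :=
  @IncHom K c S L (GRing.Linear.clone _ _ _ _ (val : sub_car S -> L) _)
    (fun t q => erefl).

Lemma sub_incl_inj L (S : incSubmodule L) : injective (sub_incl S).
Proof. exact: val_inj. Qed.

Lemma sub_inclP L (S : incSubmodule L) (x : S) : S (sub_incl S x).
Proof. by apply/asboolP; exact: (valP x). Qed.

Lemma sub_incl_onto L (S : incSubmodule L) x : S x -> exists y, sub_incl S y = x.
Proof. by move=> Sx; exists (exist _ x (asboolT Sx)). Qed.

Definition inc_hom_comp L M N (f : incHom M N) (g : incHom L M) : incHom L N.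
Proof.
refine (@IncHom K c L N (GRing.Linear.clone _ _ _ _ (f \o g) _) _).
by move=> t q /=; rewrite !inc_hom_equiv.
Defined.

Definition inc_preim M N (f : incHom M N) (S : incSubmodule N) : incSubmodule M.
Proof.
refine (@IncSubmodule K c M (fun x => S (f x)) _ _ _ _).
- by rewrite raddf0; apply: in_sub0.
- by move=> x y Sx Sy; rewrite raddfD; apply: in_subD.
- by move=> a x Sx; rewrite linearZ; apply: in_subZ.
- by move=> t x Sx; rewrite inc_hom_equiv; apply: in_sub_act.
Defined.

Definition inc_image M N (f : incHom M N) (S : incSubmodule M) : incSubmodule N.
Proof.
refine (@IncSubmodule K c N (fun y => exists2 x, S x & f x = y) _ _ _ _).
- by exists 0; [exact: in_sub0 | rewrite raddf0].
- move=> _ _ [x Sx <-] [y Sy <-]; exists (x + y); last by rewrite raddfD.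
  exact: in_subD.
- move=> a _ [x Sx <-]; exists (a *: x); last by rewrite linearZ.
  exact: in_subZ.
- move=> t _ [x Sx <-]; exists (inc_act t x); last by rewrite inc_hom_equiv.
  exact: in_sub_act.
Defined.

Definition inc_null M : incSubmodule M.
Proof.
refine (@IncSubmodule K c M (fun x => x = 0) erefl _ _ _).
- by move=> _ _ -> ->; rewrite addr0.
- by move=> a _ ->; rewrite scaler0.
- by move=> t _ ->; rewrite inc_act0.
Defined.

Definition inc_full M : incSubmodule M :=
  @IncSubmodule K c M (fun=> True) I (fun _ _ _ _ => I) (fun _ _ _ => I)
    (fun _ _ _ => I).

Definition inc_ker M N (f : incHom M N) : incSubmodule M :=
  inc_preim f (inc_null N).

Lemma inc_fg_surj M N (f : incHom M N) :
  (forall y, exists x, f x = y) -> inc_fg M -> inc_fg N.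
Proof.
move=> f_surj [s sM]; exists (map f s) => S Ss y.
have [x <-] := f_surj y; apply: (sM (inc_preim f S)) => z zs.
by apply: Ss; apply: map_f.
Qed.

Lemma inc_fg_iso M N (f : incHom M N) : bijective f -> inc_fg N -> inc_fg M.
Proof.
move=> [g fK gK] [s sN]; exists (map g s) => S Ss x.
have [|y Sy /(can_inj fK) <- //] := sN (inc_image f S) _ (f x).
by move=> q qs; exists (g q); [apply: Ss; apply: map_f | rewrite gK].
Qed.

Lemma inc_fg_dsum M N : inc_fg M -> inc_fg N -> inc_fg (inc_dsum M N).
Proof.
move=> [s sM] [s' sN].
have inlP : exists f : incHom M (inc_dsum M N), forall x, f x = (x, 0).
  pose f (x : M) : inc_dsum M N := (x, 0).
  have fP : linear f by move=> a x y; congr (_, _); rewrite /= scaler0 addr0.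
  pose fL : {linear M -> inc_dsum M N} :=
    HB.pack f (GRing.isLinear.Build _ _ _ _ f fP).
  have fE t q : fL (inc_act t q) = inc_act t (fL q).
    by congr (_, _); rewrite inc_act0.
  by exists (IncHom fE).
have inrP : exists f : incHom N (inc_dsum M N), forall x, f x = (0, x).
  pose f (x : N) : inc_dsum M N := (0, x).
  have fP : linear f by move=> a x y; congr (_, _); rewrite /= scaler0 addr0.
  pose fL : {linear N -> inc_dsum M N} :=
    HB.pack f (GRing.isLinear.Build _ _ _ _ f fP).
  have fE t q : fL (inc_act t q) = inc_act t (fL q).
    by congr (_, _); rewrite inc_act0.
  by exists (IncHom fE).
have [f fP] := inlP; have [g gP] := inrP.
exists (map f s ++ map g s') => S Ss [x y].
have -> : (x, y) = f x + g y.
  by rewrite fP gP; congr (_, _); rewrite /= ?addr0 ?add0r.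
apply: in_subD.
  apply: (sM (inc_preim f S)) => q qs; apply: Ss.
  by rewrite mem_cat map_f.
apply: (sN (inc_preim g S)) => q qs; apply: Ss.
by rewrite mem_cat map_f ?orbT.
Qed.

Definition agree_below (n : nat) (s t : inc) : Prop :=
  forall i, (i < n)%N -> s i = t i.

Lemma agree_below_le m n s t : (m <= n)%N -> agree_below n s t -> agree_below m s t.
Proof. by move=> mn st i im; apply: st; apply: leq_trans mn. Qed.

Definition width_le M (n : nat) (q : M) : Prop :=
  forall s t, agree_below n s t -> inc_act s q = inc_act t q.

Definition finite_width M : Prop := forall q : M, exists n, width_le n q.

Lemma width_le_trans M m n (q : M) : (m <= n)%N -> width_le m q -> width_le n q.
Proof. by move=> mn qm s t /(agree_below_le mn); apply: qm. Qed.

Lemma width_leD M n (x y : M) : width_le n x -> width_le n y -> width_le n (x + y).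
Proof. by move=> xn yn s t st; rewrite !inc_actD (xn s t st) (yn s t st). Qed.

Lemma width_le_scale M n a (x : M) :
  (forall s t, agree_below n s t -> inc_poly s a = inc_poly t a) ->
  width_le n x -> width_le n (a *: x).
Proof. by move=> an xn s t st; rewrite !inc_actZ (xn s t st) (an s t st). Qed.

Lemma finite_width_inj M N (f : incHom M N) :
  injective f -> finite_width N -> finite_width M.
Proof.
move=> f_inj wN q; have [n qn] := wN (f q); exists n => s t st.
by apply: f_inj; rewrite !inc_hom_equiv; apply: qn.
Qed.

Lemma finite_width_dsum M N :
  finite_width M -> finite_width N -> finite_width (inc_dsum M N).
Proof.
move=> wM wN [x y]; have [m xm] := wM x; have [n yn] := wN y.
exists (maxn m n) => s t st; congr (_, _).
  by apply: xm; apply: agree_below_le st; apply: leq_maxl.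
by apply: yn; apply: agree_below_le st; apply: leq_maxr.
Qed.

Lemma inc_cm_agree (m : {cmonom ('I_c * nat)%type}) :
  exists n, forall s t, agree_below n s t -> inc_cm s m = inc_cm t m.
Proof.
exists (\max_(v <- finsupp m) v.2.+1)%N => s t st.
rewrite /inc_cm; apply: eq_big_seq => v vm; congr (cm_pow (_, _) _); apply: st.
exact: (leq_bigmax_seq (r := enum_fset (finsupp m)) (P := xpredT)
          (F := fun v => v.2.+1) _ vm isT).
Qed.

End IncModules.

(** * Generators, universal property and bases of free modules *)

Section FreeOn.
Variables (K : comNzRingType) (c : nat).
Local Notation P := (incpoly K c).
Variables (B : choiceType) (actB : inc -> B -> B).
Hypothesis actB_id : forall b, actB inc_id b = b.
Hypothesis actB_comp : forall s t b, actB (inc_comp s t) b = actB s (actB t b).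
Local Notation F := (inc_free_on K c actB_id actB_comp).
Local Notation term := (@free_term K c B actB actB_id actB_comp).
Local Notation coef := (@free_coef K c B actB actB_id actB_comp).

Definition free_gen (b : B) : F := << (1 : P) *g b >>.

Lemma free_term_gen k x : term k x = (<< k *g x.2 >> : P) *: free_gen x.1.
Proof. by rewrite /free_gen malgZU mulr1. Qed.

Lemma act_free_gen t b : inc_act t (free_gen b) = free_gen (actB t b).
Proof. by rewrite /free_gen /= free_actU inc_poly1. Qed.

Lemma act_free_term t k x :
  inc_act t (term k x) = term k (actB t x.1, inc_cm t x.2).
Proof. by rewrite /free_term /= free_actU inc_polyU. Qed.

Lemma free_on_width : (forall b, exists n, forall s t, agree_below n s t ->
  actB s b = actB t b) -> finite_width F.
Proof.
move=> wB; apply: free_ind => [|u v [m um] [n vn]|k x].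
- by exists 0%N => s t _; rewrite !inc_act0.
- exists (maxn m n); apply: width_leD.
    by apply: width_le_trans um; apply: leq_maxl.
  by apply: width_le_trans vn; apply: leq_maxr.
- have [m xm] := inc_cm_agree x.2; have [n xn] := wB x.1.
  rewrite free_term_gen; exists (maxn m n); apply: width_le_scale => s t st.
    have stm : agree_below m s t by apply: agree_below_le st; apply: leq_maxl.
    by rewrite !inc_polyU (xm s t stm).
  have stn : agree_below n s t by apply: agree_below_le st; apply: leq_maxr.
  by rewrite !act_free_gen (xn s t stn).
Qed.

Lemma free_on_fg (sB : seq B) :
  (forall b, exists t b0, b0 \in sB /\ actB t b0 = b) -> inc_fg F.
Proof.
move=> sBP; exists (map free_gen sB) => S Ss; apply: free_ind => [|u v|k x].
- exact: in_sub0.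
- exact: in_subD.
- rewrite free_term_gen; apply: in_subZ.
  have [t [b [bs <-]]] := sBP x.1; rewrite -act_free_gen; apply: in_sub_act.
  by apply: Ss; apply: map_f.
Qed.

End FreeOn.

Section FreeLift.
Variables (K : comNzRingType) (c : nat).
Local Notation P := (incpoly K c).
Variables (B : choiceType) (actB : inc -> B -> B).
Hypothesis actB_id : forall b, actB inc_id b = b.
Hypothesis actB_comp : forall s t b, actB (inc_comp s t) b = actB s (actB t b).
Local Notation F := (inc_free_on K c actB_id actB_comp).
Local Notation gen := (@free_gen K c B actB actB_id actB_comp).
Local Notation term := (@free_term K c B actB actB_id actB_comp).
Variables (M : incModule K c) (h : B -> M).
Hypothesis h_act : forall t b, h (actB t b) = inc_act t (h b).

Definition free_lift_fun (u : F) : M := \sum_(b <- msupp u) u@_b *: h b.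

Lemma free_lift_funEw (D : {fset B}) u : (msupp u `<=` D)%fset ->
  free_lift_fun u = \sum_(b <- D) u@_b *: h b.
Proof.
move=> uD; apply: big_fset_incl => // b _ /mcoeff_outdom ->.
by rewrite scale0r.
Qed.

Fact free_lift_linear : linear free_lift_fun.
Proof.
move=> a u v; set D := (msupp u `|` msupp v)%fset.
have uD : (msupp u `<=` D)%fset by apply: fsubsetUl.
have vD : (msupp v `<=` D)%fset by apply: fsubsetUr.
have auvD : (msupp (a *: u + v) `<=` D)%fset.
  apply: fsubset_trans (msuppD_le _ _) _.
  by apply: fsetUSS => //; apply: msuppZ_le.
rewrite (free_lift_funEw uD) (free_lift_funEw vD) (free_lift_funEw auvD).
rewrite scaler_sumr -big_split; apply: eq_bigr => b _ /=.
by rewrite mcoeffD mcoeffZ scalerDl scalerA.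
Qed.

HB.instance Definition _ :=
  GRing.isLinear.Build P F M _ free_lift_fun free_lift_linear.

Lemma free_lift_fun_term k x :
  free_lift_fun (term k x) = (<< k *g x.2 >> : P) *: h x.1.
Proof. by rewrite (free_lift_funEw msuppU_le) big_seq_fset1 mcoeffUU. Qed.

Lemma free_lift_fun_gen b : free_lift_fun (gen b) = h b.
Proof.
by rewrite (free_lift_funEw msuppU_le) big_seq_fset1 mcoeffUU scale1r.
Qed.

Fact free_lift_equiv t u :
  free_lift_fun (inc_act t u) = inc_act t (free_lift_fun u).
Proof.
move: u; apply: free_ext => [u v|u v|k x].
- by rewrite inc_actD raddfD.
- by rewrite raddfD inc_actD.
- apply: etrans (congr1 free_lift_fun (act_free_term _ _ t k x)) _.
  apply: etrans (free_lift_fun_term k _) _.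
  apply: etrans _ (congr1 (inc_act t) (esym (free_lift_fun_term k x))).
  rewrite inc_actZ.
  rewrite inc_polyU.
  by rewrite h_act.
Qed.

Definition free_lift : incHom F M := IncHom free_lift_equiv.

Lemma free_lift_gen b : free_lift (gen b) = h b.
Proof. exact: free_lift_fun_gen. Qed.

End FreeLift.

Lemma sum_uniq_delta (R : pzRingType) (T : eqType) (s : seq T) (a : T -> R) x :
  uniq s -> x \in s -> \sum_(y <- s) a y * (y == x)%:R = a x.
Proof.
move=> s_uniq xs; rewrite (big_rem x xs) /= eqxx mulr1 big_seq big1 ?addr0 // => y.
by case: eqP => [->|]; rewrite ?mulr0 // mem_rem_uniqF.
Qed.

Section FreeBasis.
Variables (K : comNzRingType) (c : nat).
Local Notation P := (incpoly K c).
Variables (B : choiceType) (actB : inc -> B -> B).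
Hypothesis actB_id : forall b, actB inc_id b = b.
Hypothesis actB_comp : forall s t b, actB (inc_comp s t) b = actB s (actB t b).
Local Notation F := (inc_free_on K c actB_id actB_comp).
Local Notation gen := (@free_gen K c B actB actB_id actB_comp).

Lemma mcoeff_gen b b' : (gen b)@_b' = (b == b')%:R.
Proof. by rewrite mcoeffU. Qed.

Lemma free_gen_inj : injective gen.
Proof.
move=> b b' e; apply/eqP; have := mcoeff_gen b' b'; rewrite -e mcoeff_gen eqxx.
by case: eqP => // _ /esym/eqP; rewrite oner_eq0.
Qed.

Lemma free_gen_basis : is_basis (fun x : F => exists b, x = gen b).
Proof.
split=> [u|s a s_uniq sB sum0 x xs].
  exists (map gen (enum_fset (msupp u))).
  (* [is_basis] indexes scalars by elements of [F]; as [gen] is injective, this sum has at most one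
     summand. *)
  exists (fun x : F => \sum_(b <- msupp u | gen b == x) u@_b).
  split=> [_ /mapP [b _ ->]|]; first by exists b.
  rewrite big_map [LHS]monalgE; apply: eq_big_seq => b bu.
  rewrite (big_rem b bu) eqxx /= big_seq_cond big1 ?addr0; last first.
    move=> b' /andP[b'u /eqP /free_gen_inj e].
    by rewrite e mem_rem_uniqF // in b'u; apply: fset_uniq.
  by rewrite /free_gen malgZU mulr1.
have [b xE] := sB x xs.
rewrite -(sum_uniq_delta a s_uniq xs).
have sumE := raddf_sum (mcoeff b : {additive F -> P}) s xpredT (fun y => a y *: y).
have sumb : \sum_(y <- s) (a y *: y)@_b = 0.
  exact: etrans (etrans (esym sumE) (congr1 (mcoeff b) sum0)) (mcoeff0 b).
apply: etrans sumb; apply: eq_big_seq => y ys.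
apply: etrans _ (esym (mcoeffZ (a y) y b)); congr (_ * _).
by have [b' ->] := sB y ys; rewrite xE mcoeff_gen (inj_eq free_gen_inj).
Qed.

End FreeBasis.

(** * Covering a module of finite width by a power of F^(Inc,d) *)

Section OI.
Variables (K : comNzRingType) (c d : nat).

Lemma homOI_lt (p : homOI d) (i j : 'I_d) : (i < j)%N -> (val p i < val p j)%N.
Proof. by move: (valP p) => /forallP/(_ i)/forallP/(_ j)/implyP. Qed.

Lemma homOI_extend (p : homOI d) : exists t : inc, forall l : 'I_d, t l = val p l.
Proof.
pose m := \max_l val p l.
(* From [d] on, the shift by the maximum [m] keeps the values above all those of [p]. *)
pose f i := if insub i : option 'I_d is Some l then val p l else (m + i.+1)%N.
have f_mono i j : (i < j)%N -> (f i < f j)%N.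
  move=> ij; rewrite /f.
  case: (insubP _ j) => [l jd lj|jd]; case: (insubP _ i) => [k id' ki|id'].
  - by apply: homOI_lt; rewrite ki lj.
  - by rewrite (ltn_trans ij jd) in id'.
  - have le := leq_bigmax (F := fun l => val p l) k.
    by rewrite addnS ltnS (leq_trans le) ?leq_addr.
  - by rewrite ltn_add2l.
by exists (MkInc f_mono) => l /=; rewrite /f valK.
Qed.

Definition homOI_ext (p : homOI d) : inc := sval (cid (homOI_extend p)).

Lemma homOI_extE p (l : 'I_d) : homOI_ext p l = val p l.
Proof. by rewrite /homOI_ext; case: cid. Qed.

Fact homOI_incl_subproof :
  [forall i : 'I_d, forall j : 'I_d, (i < j)%N ==>
     ([ffun k : 'I_d => val k] i < [ffun k : 'I_d => val k] j)%N].
Proof.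
by apply/forallP => i; apply/forallP => j; apply/implyP; rewrite !ffunE.
Qed.

Definition homOI_incl : homOI d := Sub [ffun k => val k] homOI_incl_subproof.

Lemma homOI_inclE (l : 'I_d) : val homOI_incl l = l.
Proof. by rewrite ffunE. Qed.

Lemma homOI_comp_incl (p : homOI d) : homOI_comp (homOI_ext p) homOI_incl = p.
Proof. by apply: homOI_eq => l; rewrite homOI_compE homOI_inclE homOI_extE. Qed.

Lemma homOI_comp_agree (p : homOI d) :
  exists n, forall s t, agree_below n s t -> homOI_comp s p = homOI_comp t p.
Proof.
exists (\max_l (val p l).+1)%N => s t st; apply: homOI_eq => l.
by rewrite !homOI_compE st // (leq_bigmax (F := fun l => (val p l).+1) l).
Qed.

Lemma inc_free_fg : inc_fg (inc_free K c d).
Proof.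
apply: (@free_on_fg K c _ _ _ _ [:: homOI_incl]) => p.
by exists (homOI_ext p), homOI_incl; rewrite mem_head homOI_comp_incl.
Qed.

Lemma inc_free_width : finite_width (inc_free K c d).
Proof. exact: free_on_width homOI_comp_agree. Qed.

Variable r : nat.

Lemma inc_pow_fg : inc_fg (inc_pow K c r d).
Proof.
apply: (@free_on_fg K c _ _ _ _ [seq (i, homOI_incl) | i <- enum 'I_r]) => -[i p].
exists (homOI_ext p), (i, homOI_incl); rewrite /pow_act /= homOI_comp_incl.
by split=> //; apply: map_f; rewrite mem_enum.
Qed.

Lemma inc_pow_width : finite_width (inc_pow K c r d).
Proof.
apply: free_on_width => -[i p]; have [n pn] := homOI_comp_agree p.
by exists n => s t /pn st; rewrite /pow_act /= st.
Qed.

Section PowLift.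
Variables (M : incModule K c) (g : 'I_r -> M).
Hypothesis g_width : forall i, width_le d (g i).

Definition pow_lift_gen (b : 'I_r * homOI d) : M :=
  inc_act (homOI_ext b.2) (g b.1).

(** The extension chosen for the composite of [t] with [b.2] may differ from [t] composed with the
    extension of [b.2], but both agree below [d], which suffices by the width of [g]. *)
Fact pow_lift_gen_act t b :
  pow_lift_gen (pow_act t b) = inc_act t (pow_lift_gen b).
Proof.
rewrite /pow_lift_gen -inc_act_comp; apply: g_width => i id' /=.
have := homOI_extE b.2 (Ordinal id').
have := homOI_extE (pow_act t b).2 (Ordinal id').
by rewrite /= ffunE => -> ->.
Qed.

Definition pow_lift : incHom (inc_pow K c r d) M :=
  free_lift _ _ pow_lift_gen_act.

(** The image contains [g i], the value at the generator [(i, homOI_incl)], because the extension of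
    the inclusion agrees with the identity below [d]. *)
Lemma pow_lift_surj :
  (forall S : incSubmodule M, (forall i, S (g i)) -> forall q, S q) ->
  forall y, exists x, pow_lift x = y.
Proof.
move=> gM y.
have [i|x _ <-] := gM (inc_image pow_lift (inc_full _)) _ y; last by exists x.
exists (free_gen _ _ _ _ (i, homOI_incl)) => //.
rewrite /pow_lift free_lift_gen /pow_lift_gen /= -[RHS]inc_act_id.
by apply: g_width => j jd; rewrite (homOI_extE _ (Ordinal jd)) homOI_inclE.
Qed.

End PowLift.
End OI.

Section FiniteGeneration.
Variables (K : comNzRingType) (c : nat).
Implicit Types L M N : incModule K c.

Lemma fg_free_fg_width L : inc_fg_free L -> inc_fg L /\ finite_width L.
Proof.
move=> [ds [f f_bij]].
pose sum ds := foldr (fun d N => inc_dsum (inc_free K c d) N) (inc_zero K c) ds.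
suff [fgN wN] : inc_fg (sum ds) /\ finite_width (sum ds).
  split; first exact: inc_fg_iso f_bij fgN.
  by apply: finite_width_inj wN; apply: bij_inj f_bij.
elim: ds {f f_bij} => [|d ds [fgN wN]] /=.
  split; last by apply: free_on_width => -[].
  by apply: (@free_on_fg K c _ _ _ _ [::]) => -[].
split; first by apply: inc_fg_dsum fgN; apply: inc_free_fg.
by apply: finite_width_dsum wN; apply: inc_free_width.
Qed.

Definition generates M (r : nat) (g : 'I_r -> M) : Prop :=
  forall S : incSubmodule M, (forall i, S (g i)) -> forall q, S q.

Lemma fg_generates M : inc_fg M -> exists r (g : 'I_r -> M), generates g.
Proof.
move=> [s sM]; exists (size s), (fun i => s`_i) => S Sg q.
apply: sM => x /(nthP 0) [i ilt <-]; exact: (Sg (Ordinal ilt)).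
Qed.

Lemma common_width M (r : nat) (g : 'I_r -> M) :
  finite_width M -> exists d, forall i, width_le d (g i).
Proof.
move=> wM; have [d dP] := choice (fun i => wM (g i)).
exists (\max_i d i)%N => i; apply: width_le_trans (dP i).
exact: leq_bigmax.
Qed.

Lemma inc_hom_cores M L (S : incSubmodule L) (f : incHom M L)
    (fS : forall x, S (f x)) :
  exists g : incHom M S, forall x, sub_incl S (g x) = f x.
Proof.
pose g (x : M) : S := exist _ (f x) (asboolT (fS x)).
have gP : linear g by move=> a x y; apply: val_inj; rewrite /= linearP.
pose gL : {linear M -> S} := HB.pack g (GRing.isLinear.Build _ _ _ _ g gP).
have gE t q : gL (inc_act t q) = inc_act t (gL q).
  by apply: val_inj; rewrite /= inc_hom_equiv.
by exists (IncHom gE).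
Qed.

Hypotheses (hK : noetherian_ring K) (hc : (0 < c)%N).

(** [L] is a quotient of a power of F^(Inc,d). The preimage of [S] there is finitely generated by
    the Groebner argument, and it maps onto [S]. *)
Lemma fg_sub L (S : incSubmodule L) : inc_fg L -> finite_width L -> inc_fg S.
Proof.
move=> fgL wL; have [r [g gL]] := fg_generates fgL.
have [d gd] := common_width g wL; pose e := pow_lift gd.
have e_surj := pow_lift_surj gd gL.
pose S' := inc_preim e S.
have fgS' : inc_fg S' := inc_fg_into_pow hc hK (@sub_incl_inj _ _ _ S').
have [f fE] := @inc_hom_cores _ _ S (inc_hom_comp e (sub_incl S'))
  (fun x => sub_inclP x).
apply: (inc_fg_surj (f := f)) fgS' => y.
have [x xE] := e_surj (sub_incl S y).
have [|x' x'E] := @sub_incl_onto _ _ _ S' x.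
  by rewrite /= -/e xE; apply: sub_inclP.
by exists x'; apply: sub_incl_inj; rewrite fE -xE -x'E.
Qed.

Lemma sub_width L (S : incSubmodule L) : finite_width L -> finite_width S.
Proof. exact: finite_width_inj (@sub_incl_inj _ _ _ S). Qed.

End FiniteGeneration.

(** * Gradings *)

Section Homogeneous.
Variables (V : zmodType) (piece : int -> V -> Prop).
Hypothesis piece0 : forall n, piece n 0.
Hypothesis pieceD : forall n x y, piece n x -> piece n y -> piece n (x + y).

(** A normal form of [piece_span]: with distinct degrees and zero components elsewhere, sums can be
    merged and [piece_indep] applies. *)
Definition homog_sum (x : V) : Prop := exists (s : seq int) (f : int -> V),
  [/\ uniq s, forall n, piece n (f n), forall n, n \notin s -> f n = 0
    & x = \sum_(n <- s) f n].

Lemma homog_sum0 : homog_sum 0.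
Proof. by exists [::], (fun=> 0); split=> //; rewrite big_nil. Qed.

Lemma homog_sum1 n x : piece n x -> homog_sum x.
Proof.
move=> px; exists [:: n], (fun m => if m == n then x else 0); split=> // [m|m|].
- by case: eqP => [->|].
- by rewrite inE => /negPf ->.
- by rewrite big_seq1 eqxx.
Qed.

Lemma homog_sumD x y : homog_sum x -> homog_sum y -> homog_sum (x + y).
Proof.
move=> [s [f [us pf f0 ->]]] [s' [f' [us' pf' f'0 ->]]].
pose S := undup (s ++ s').
have ext (t : seq int) (h : int -> V) : uniq t -> {subset t <= S} ->
    (forall n, n \notin t -> h n = 0) -> \sum_(n <- t) h n = \sum_(n <- S) h n.
  move=> ut tS h0; rewrite [RHS](bigID (mem t)) /= [X in _ + X]big1 ?addr0 //.
  rewrite -[RHS]big_filter; apply: perm_big; apply: uniq_perm => //.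
    by rewrite filter_uniq // undup_uniq.
  by move=> n; rewrite mem_filter; case: (boolP (n \in t)) => //= /tS ->.
exists S, (fun n => f n + f' n); split.
- exact: undup_uniq.
- by move=> n; apply: pieceD.
- move=> n; rewrite mem_undup mem_cat negb_or => /andP[/f0-> /f'0->].
  by rewrite addr0.
- rewrite big_split; congr (_ + _); apply: ext => // n ns;
    by rewrite mem_undup mem_cat ns ?orbT.
Qed.

Lemma homog_sum_sum (s : seq int) (f : int -> V) :
  (forall n, piece n (f n)) -> homog_sum (\sum_(n <- s) f n).
Proof.
move=> pf; apply: big_ind => [||n _]; [exact: homog_sum0|exact: homog_sumD|].
exact: homog_sum1 (pf n).
Qed.

End Homogeneous.

Section Gradings.
Variables (K : comNzRingType) (c : nat).
Local Notation P := (incpoly K c).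
Implicit Types M N : incModule K c.

Lemma pieceD M (gM : incGrading M) n x y : gM n x -> gM n y -> gM n (x + y).
Proof.
move=> px py; rewrite -[y]opprK; apply: pieceB => //.
by rewrite -sub0r; apply: pieceB => //; apply: piece0.
Qed.

Lemma grading_homog_sum M (gM : incGrading M) x : homog_sum gM x.
Proof.
have [s [f [pf ->]]] := piece_span gM x.
by apply: homog_sum_sum => //; [exact: piece0 | exact: pieceD].
Qed.

(** Each generator is replaced by its homogeneous components, which together generate it. *)
Lemma homog_generates M (gM : incGrading M) : inc_fg M ->
  exists r (g : 'I_r -> M) (deg : 'I_r -> int),
    generates g /\ forall i, gM (deg i) (g i).
Proof.
move=> [s sM].
have [l lP lgen] : exists2 l : seq (int * M), forall p, p \in l -> gM p.1 p.2 &
    forall S : incSubmodule M, (forall p, p \in l -> S p.2) ->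
      forall q, q \in s -> S q.
  elim: s {sM} => [|x s [l lP lgen]]; first by exists [::].
  have [sx [f [_ pf _ xE]]] := grading_homog_sum gM x.
  exists ([seq (n, f n) | n <- sx] ++ l) => [p|S Sl q].
    by rewrite mem_cat => /orP[/mapP [n _ ->]|/lP].
  rewrite inE => /predU1P[->|qs]; last first.
    by apply: lgen qs => p pl; apply: Sl; rewrite mem_cat pl orbT.
  rewrite xE big_seq; apply: in_sub_sum => n nsx; apply: (Sl (n, f n)).
  by rewrite mem_cat map_f.
exists (size l), (fun i => (tnth (in_tuple l) i).2).
exists (fun i => (tnth (in_tuple l) i).1).
split=> [S Sg q|i]; last by apply: lP; apply: mem_tnth.
apply: sM; apply: lgen => p /(nthP (0, 0)) [i il <-].
by have := Sg (Ordinal il); rewrite (tnth_nth (0, 0)).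
Qed.

Section Kernel.
Variables (M N : incModule K c) (gM : incGrading M) (gN : incGrading N).
Variable f : incHom M N.
Hypothesis f0 : degree_zero gM gN f.

Let kpiece (n : int) (x : inc_ker f) : Prop := gM n (sub_incl (inc_ker f) x).

(** If [x] is in the kernel, the images of its components are homogeneous of distinct degrees with
    sum zero, so each vanishes by independence in [N]. *)
Fact ker_piece_span x : exists (s : seq int) (h : int -> inc_ker f),
  (forall n, kpiece n (h n)) /\ x = \sum_(n <- s) h n.
Proof.
have [s [h [us ph h0 xE]]] := grading_homog_sum gM (sub_incl _ x).
have kh n : f (h n) = 0.
  have [ns|/h0 ->] := boolP (n \in s); last by rewrite raddf0.
  apply: (@piece_indep _ _ _ gN s (fun n => f (h n))) ns => // [m|].
    by apply: f0.
  by rewrite -raddf_sum -xE; exact: (sub_inclP x).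
have /choice [k kE] n := sub_incl_onto (S := inc_ker f) (kh n).
exists s, k; split=> [n|]; first by rewrite /kpiece kE.
apply: sub_incl_inj; rewrite xE raddf_sum.
by apply: eq_bigr => n _; exact: esym (kE n).
Qed.

Fact ker_piece_indep (s : seq int) (h : int -> inc_ker f) : uniq s ->
  (forall n, kpiece n (h n)) -> \sum_(n <- s) h n = 0 ->
  forall n, n \in s -> h n = 0.
Proof.
move=> us ph h0 n ns; apply: sub_incl_inj; rewrite raddf0.
apply: (@piece_indep _ _ _ gM s (fun n => sub_incl _ (h n))) ns => //.
by rewrite -raddf_sum h0 raddf0.
Qed.

Definition ker_grading : incGrading (inc_ker f).
Proof.
refine (@IncGrading K c _ kpiece _ _ ker_piece_span ker_piece_indep _ _).
- by move=> n; rewrite /kpiece raddf0; apply: piece0.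
- by move=> n x y px py; rewrite /kpiece raddfB; apply: pieceB.
- by move=> k n a x ka px; rewrite /kpiece linearZ; apply: pieceZ.
- by move=> t n x px; rewrite /kpiece inc_hom_equiv; apply: piece_act.
Defined.

End Kernel.

Section FreeGrading.
Variables (B : choiceType) (actB : inc -> B -> B).
Hypothesis actB_id : forall b, actB inc_id b = b.
Hypothesis actB_comp : forall s t b, actB (inc_comp s t) b = actB s (actB t b).
Hypothesis actB_inj : forall t, injective (actB t).
Variable deg : B -> int.
Hypothesis deg_act : forall t b, deg (actB t b) = deg b.
Local Notation mon := {cmonom ('I_c * nat)%type}.
Local Notation F := (inc_free_on K c actB_id actB_comp).
Local Notation term := (@free_term K c B actB actB_id actB_comp).
Local Notation coef := (@free_coef K c B actB actB_id actB_comp).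
Local Notation gen := (@free_gen K c B actB actB_id actB_comp).

(** The standard grading with the basis element at [b] placed in degree [deg b]; invariance of [deg]
    under Inc makes the action preserve degrees. *)
Definition term_deg (x : B * mon) : int := (mdeg x.2)%:Z + deg x.1.

Definition free_piece (n : int) (u : F) : Prop :=
  forall x, coef x u <> 0 -> term_deg x = n.

Fact free_piece0 n : free_piece n 0.
Proof. by move=> x; rewrite raddf0. Qed.

Fact free_pieceB n u v : free_piece n u -> free_piece n v -> free_piece n (u - v).
Proof.
move=> pu pv x; rewrite raddfB => uv.
have [u0|/pu //] := pselect (coef x u = 0).
by apply: pv => v0; apply: uv; rewrite u0 v0 subr0.
Qed.

Fact free_pieceD n u v : free_piece n u -> free_piece n v -> free_piece n (u + v).
Proof.
move=> pu pv x; rewrite raddfD => uv.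
have [u0|/pu //] := pselect (coef x u = 0).
by apply: pv => v0; apply: uv; rewrite u0 v0 addr0.
Qed.

Lemma free_piece_term k x : free_piece (term_deg x) (term k x).
Proof. by move=> y; rewrite free_coefU; case: eqP => // ->. Qed.

Fact free_piece_span u : exists (s : seq int) (f : int -> F),
  (forall n, free_piece n (f n)) /\ u = \sum_(n <- s) f n.
Proof.
suff [s [f [_ pf _ ->]]] : homog_sum free_piece u by exists s, f.
move: u; apply: free_ind => [|u v uP vP|k x].
- exact: homog_sum0 free_piece0.
- apply: homog_sumD uP vP; exact: free_pieceD.
- exact: (@homog_sum1 _ free_piece (@free_piece0) _ _ (@free_piece_term k x)).
Qed.

Fact free_piece_indep (s : seq int) (f : int -> F) : uniq s ->
  (forall n, free_piece n (f n)) -> \sum_(n <- s) f n = 0 ->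
  forall n, n \in s -> f n = 0.
Proof.
move=> us pf f0 n ns; apply: free_coef_eq0 => x; apply: contrapT => fx.
have xn := pf n x fx; apply: fx.
have := raddf_sum (coef x) s xpredT f; rewrite f0 raddf0.
move=> /esym; rewrite (big_rem n ns) /= big_seq big1 ?addr0 // => m ms.
apply: contrapT => /pf; rewrite xn => mn.
by rewrite -mn mem_rem_uniqF in ms.
Qed.

Fact free_pieceZ k n a u :
  poly_homog k a -> free_piece n u -> free_piece (k%:Z + n) (a *: u).
Proof.
move=> ka pu [b m].
have -> : coef (b, m) (a *: u) = (a * u@_b)@_m by rewrite /= mcoeffZ.
move/eqP; rewrite mcoeff_neq0 => /msuppM_le [m1 [m2 [/ka m1k m2u ->]]].
rewrite /term_deg /= mdegM PoszD m1k -addrA; congr (_ + _).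
by apply: (pu (b, m2)); apply/eqP; rewrite /= mcoeff_neq0.
Qed.

Fact free_piece_act t n u : free_piece n u -> free_piece n (inc_act t u).
Proof.
move=> pu y; have -> : inc_act t u = term_op mone t u.
  by rewrite /term_op -[LHS]scale1r.
have [[x <-]|no] := pselect (exists x, act_term actB mone t x = y); last first.
  by case; apply: free_coef_op_out => x xy; apply: no; exists x.
rewrite free_coef_op // => /pu <-.
by rewrite /term_deg /= mul1m mdeg_inc_cm deg_act.
Qed.

Definition free_grading : incGrading F :=
  IncGrading (@free_piece0) (@free_pieceB) free_piece_span free_piece_indep
    (@free_pieceZ) (@free_piece_act).

Lemma free_grading_gen b : free_grading (deg b) (gen b).
Proof.
have := @free_piece_term 1 (b, mone).
by rewrite free_term_gen /term_deg /= mdeg1 add0r scale1r.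
Qed.

Lemma free_lift_degree_zero M (gM : incGrading M) (h : B -> M)
    (h_act : forall t b, h (actB t b) = inc_act t (h b)) :
  (forall b, gM (deg b) (h b)) ->
  degree_zero free_grading gM (free_lift actB_id actB_comp h_act).
Proof.
move=> gh n u pu; rewrite /= /free_lift_fun; apply: big_ind => [||b _].
- exact: piece0.
- exact: pieceD.
have [->|/malgP/existsNP [m]] := pselect (u@_b = 0).
  by rewrite scale0r; apply: piece0.
(* One monomial [m] of [u@_b] fixes the degree: homogeneity of [u] forces every other monomial of
   [u@_b] to have the degree of [m]. *)
rewrite mcoeff0 => um; rewrite -(pu (b, m) um); apply: pieceZ (gh b) => m' m'u.
have um' : coef (b, m') u <> 0 by apply/eqP; rewrite /= mcoeff_neq0.
have := pu (b, m') um'; rewrite -(pu (b, m) um).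
by move=> /addIr [].
Qed.

End FreeGrading.
End Gradings.

Local Close Scope ring_scope.

(** * Resolutions *)

Section Resolution.
Variables (K : comNzRingType) (c : nat).
(* G is [incGrading] in the graded case and trivial in the ungraded one. *)
Variables (G : incModule K c -> Type)
  (compat : forall M N, G M -> G N -> (M -> N) -> Prop)
  (good : forall F, G F -> Prop).

(** The kernel carries its own structure, compatible with the inclusion, because it is the module to
    be covered next. *)
Definition cover (M : incModule K c) (gM : G M) : Prop :=
  exists (F : incModule K c) (gF : G F) (e : incHom F M) (gk : G (inc_ker e)),
    [/\ forall y, exists x, e x = y, good gF /\ inc_fg F,
        inc_fg (inc_ker e) /\ finite_width (inc_ker e), compat gF gM e
      & compat gk gF (sub_incl (inc_ker e))].

Hypothesis compat_comp : forall M N R (gM : G M) (gN : G N) (gR : G R)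
    (f : incHom M N) (h : incHom N R),
  compat gM gN f -> compat gN gR h -> compat gM gR (inc_hom_comp h f).
Hypothesis coverP : forall (M : incModule K c) (gM : G M),
  inc_fg M -> finite_width M -> cover gM.

Record stage := Stage {
  stage_mod : incModule K c;
  stage_str : G stage_mod;
  stage_fg : inc_fg stage_mod;
  stage_width : finite_width stage_mod }.

(** The existentials of [cover] become fields, so that one cover per stage can be selected by choice
    and iterated. *)
Record stage_cover (s : stage) := StageCover {
  cov_mod : incModule K c;
  cov_str : G cov_mod;
  cov_hom : incHom cov_mod (stage_mod s);
  cov_ker : G (inc_ker cov_hom);
  cov_surj : forall y, exists x, cov_hom x = y;
  cov_good : good cov_str /\ inc_fg cov_mod;
  cov_ker_fg : inc_fg (inc_ker cov_hom) /\ finite_width (inc_ker cov_hom);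
  cov_compat : compat cov_str (stage_str s) cov_hom;
  cov_ker_compat : compat cov_ker cov_str (sub_incl (inc_ker cov_hom)) }.

Lemma stage_cover_exists s : exists _ : stage_cover s, True.
Proof.
have [F [gF [e [gk [h1 h2 h3 h4 h5]]]]] :=
  coverP (stage_str s) (stage_fg s) (@stage_width s).
by exists (StageCover h1 h2 h3 h4 h5).
Qed.

Definition cov s : stage_cover s := sval (cid (stage_cover_exists s)).

Definition next_stage (s : stage) : stage :=
  Stage (cov_ker (cov s)) (cov_ker_fg (cov s)).1 (cov_ker_fg (cov s)).2.

(** Each differential is a cover of the previous kernel followed by its inclusion. Surjectivity of
    the cover makes its image that kernel, and injectivity of the inclusion makes its own kernel
    that of the cover. *)
Lemma resolution_of_covers (M : incModule K c) (gM : G M) :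
  inc_fg M -> finite_width M ->
  exists (F : nat -> incModule K c) (e : incHom (F 0) M)
    (d : forall n, incHom (F n.+1) (F n)) (gF : forall n, G (F n)),
    [/\ inc_exact e d, forall n, good (gF n), forall n, inc_fg (F n),
        compat (gF 0) gM e & forall n, compat (gF n.+1) (gF n) (d n)].
Proof.
move=> fgM wM; pose st n := iter n next_stage (Stage gM fgM wM).
pose e n := cov_hom (cov (st n)).
pose d n : incHom (cov_mod (cov (st n.+1))) (cov_mod (cov (st n))) :=
  inc_hom_comp (sub_incl (inc_ker (e n))) (e n.+1).
have kerP n x : e n x = 0%R <-> exists y, d n y = x.
  split=> [ex|[y <-]]; last exact: (sub_inclP (e n.+1 y)).
  have [z <-] := @sub_incl_onto _ _ _ (inc_ker (e n)) x ex.
  by have [y <-] := cov_surj (cov (st n.+1)) z; exists y.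
have d0 n x : d n x = 0%R <-> e n.+1 x = 0%R.
  split=> [dx|ex]; last by rewrite /d /= ex.
  by apply: (@sub_incl_inj _ _ _ (inc_ker (e n))); rewrite GRing.raddf0.
exists (fun n => cov_mod (cov (st n))), (e 0), d, (fun n => cov_str (cov (st n))).
split.
- split=> [|x|n x]; [exact: (cov_surj (cov (st 0))) | exact: (kerP 0 x) |].
  exact: (iff_trans (d0 n x) (kerP n.+1 x)).
- by move=> n; apply: (cov_good _).1.
- by move=> n; apply: (cov_good _).2.
- exact: (cov_compat (cov (st 0))).
- move=> n; apply: compat_comp (cov_compat (cov (st n.+1))) _.
  exact: (cov_ker_compat (cov (st n))).
Qed.

End Resolution.

Theorem theorem4p26 (K : comNzRingType) (c : nat)
    (hK : noetherian_ring K) (hc : (1 <= c)%N)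
    (L : incModule K c) (hL : inc_fg_free L) (M : incSubmodule L) :
  (exists (F : nat -> incModule K c) (e : incHom (F 0%N) M)
     (d : forall n, incHom (F n.+1) (F n)),
     [/\ inc_exact e d,
         forall n, free_module (F n)
       & forall n, inc_fg (F n)]) /\
  (forall gM : incGrading M,
   exists (F : nat -> incModule K c) (e : incHom (F 0%N) M)
     (d : forall n, incHom (F n.+1) (F n)) (gF : forall n, incGrading (F n)),
     [/\ inc_exact e d,
         forall n, graded_free_module (gF n),
         forall n, inc_fg (F n),
         degree_zero (gF 0%N) gM e
       & forall n, degree_zero (gF n.+1) (gF n) (d n)]).
Proof.
have [fgL wL] := fg_free_fg_width hL.
have fgM : inc_fg M := fg_sub hK hc M fgL wL.
have wM : finite_width M := sub_width (S := M) wL.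
(* Kernels are submodules of a power of F^(Inc,d), so the Groebner argument applies to them
   directly. *)
have pow_ker r d (N : incModule K c) (e : incHom (inc_pow K c r d) N) :
    inc_fg (inc_ker e) /\ finite_width (inc_ker e).
  split; first exact: (inc_fg_into_pow hc hK (@sub_incl_inj _ _ _ (inc_ker e))).
  exact: (sub_width (@inc_pow_width K c d r)).
split.
  have covers N (u : unit) : inc_fg N -> finite_width N ->
      @cover K c (fun=> unit) (fun _ _ _ _ _ => True)
        (fun F _ => free_module F) N u.
    move=> fgN wN; have [r [g gN]] := fg_generates fgN.
    have [d gd] := common_width g wN.
    exists (inc_pow K c r d), tt, (pow_lift gd), tt; split=> //.
    - exact: pow_lift_surj.
    - split; last exact: inc_pow_fg.
      by exists (fun x => exists b, x = free_gen _ _ _ _ b); apply: free_gen_basis.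
  have [//|F [e [d [_ [ex free fg _ _]]]]] :=
    resolution_of_covers _ covers tt fgM wM.
  by exists F, e, d.
move=> gM.
apply: (@resolution_of_covers K c (@incGrading K c) (@degree_zero K c)
    (@graded_free_module K c)) fgM wM.
  by move=> N1 N2 N3 g1 g2 g3 f h f0 h0 n x /f0 /h0.
move=> N gN fgN wN; have [r [g [deg [gens gdeg]]]] := homog_generates gN fgN.
have [d gd] := common_width g wN.
(* Every basis element above the generator [g i] gets the degree of [g i], so that the lift has
   degree zero. *)
pose deg' (b : 'I_r * homOI d) := deg b.1.
pose gF := @free_grading K c _ _ (@pow_act_id r d) (@pow_act_comp r d)
  (@pow_act_inj r d) deg' (fun _ _ => erefl).
have lift0 : degree_zero gF gN (pow_lift gd).
  by apply: free_lift_degree_zero => b; apply: piece_act; apply: gdeg.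
exists (inc_pow K c r d), gF, (pow_lift gd), (ker_grading lift0); split=> //.
- exact: pow_lift_surj.
- split; last exact: inc_pow_fg.
  exists (fun x => exists b, x = free_gen _ _ _ _ b); first exact: free_gen_basis.
  by move=> _ [b ->]; exists (deg' b); apply: free_grading_gen.
Qed.
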